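(* Let $p=(0,0,z_0)$ with $z_0\in B$ be a point of the codimension-two corner stratum. Then exactly one of the following alternatives occurs. (i) $A_\mu>2$; in this case $p$ is at infinite intrinsic distance and no point of the metric completion of $(U_B,d_\mu)$ lies over $p$ (the completion fibre over $p$ is empty). (ii) $A_\mu\le 2$ and $\int^\infty\sqrt{\mathcal T_\mu(S)}\,dS=\infty$; in this case $p$ is at infinite intrinsic distance and the completion fibre over $p$ is empty. (iii) $A_\mu\le 2$ and $\int^\infty\sqrt{\mathcal T_\mu(S)}\,dS<\infty$; in this case the completion fibre over $p$ consists of exactly one point, every sequence in $U_B$ converging Euclideanly to $p$ is $d_\mu$-Cauchy, and any two such sequences are equivalent (their mutual $d_\mu$-distance tends to $0$). Consequently, nonempty completion fibres with more than one point do not occur.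
   Context: Let $k\ge0$, let $V\subset\mathbb R^k$ be open, let $0<\varepsilon<1$, and let $U=[0,\varepsilon)^2\times V$ with coordinates $(x,y,z)$ (an adapted chart of a manifold with corners near the codimension-two corner stratum $\{x=y=0\}$), with $U^\circ=(0,\varepsilon)^2\times V$. Let $g_{\mathrm E}$ be the Euclidean metric and $g_0$ a smooth Riemannian metric on $U$ with $c_0g_{\mathrm E}\le g_0\le C_0g_{\mathrm E}$ for constants $0<c_0\le C_0<\infty$. Let $\mu$ be a finite nonzero positive Radon measure with compact support $E=\operatorname{supp}\mu\subset\mathbb R_{\ge0}^2$. Let $u:E\times U^\circ\to(0,\infty)$ be jointly measurable with $0<c_u\le u(\alpha;x,y,z)\le C_u<\infty$ for $\mu$-almost every $\alpha\in E$ and every $(x,y,z)\in U^\circ$, and assume that $F_\mu(x,y,z)=\int_E u(\alpha;x,y,z)x^{-\alpha_1}y^{-\alpha_2}\,d\mu(\alpha)$ is continuous and positive on $U^\circ$. Put $g_\mu=F_\mu g_0$. Fix a Euclidean ball $B$ relatively compact in $V$, and let $U_B=(0,\varepsilon)^2\times B$. Let $d_\mu$ be the intrinsic distance on $U_B$: the infimum of $g_\mu$-lengths of absolutely continuous curves contained in $U_B$. Every $d_\mu$-Cauchy sequence in $U_B$ has a unique Euclidean limit in $[0,\varepsilon]^2\times\overline B$. For $p\in\{x=y=0\}\times B$, the completion fibre over $p$ is the set of points of the metric completion of $(U_B,d_\mu)$ represented by $d_\mu$-Cauchy sequences in $U_B$ whose Euclidean limit is $p$. ''$p$ is at infinite intrinsic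 distance'' means that every absolutely continuous curve in $U_B$ converging Euclideanly to $p$ at one end has infinite $g_\mu$-length. Put $A_\mu=\max_{\alpha\in E}(\alpha_1+\alpha_2)$ and $\mathcal T_\mu(S)=\int_E e^{-S(2-\alpha_1-\alpha_2)}\,d\mu(\alpha)$ for $S\ge0$. The notation $\int^\infty$ means the integral over $[S_0,\infty)$ for some (equivalently any) $S_0\ge0$. *)

(* Defs.v *)
From HB Require Import structures.
From mathcomp Require Import all_boot all_order all_algebra.
From mathcomp Require Import all_classical all_reals all_analysis.
Set Implicit Arguments.
Unset Strict Implicit.
Unset Printing Implicit Defensive.
Import Order.TTheory GRing.Theory Num.Theory.
Import numFieldNormedType.Exports.
Local Open Scope classical_set_scope.
Local Open Scope ring_scope.

(* The library norm on 'rV[R]_n is the sup norm; it induces the Euclidean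
   topology, but metric data must use [enorm]. *)
Definition enorm (R : realType) (n : nat) (v : 'rV[R]_n) : R :=
  Num.sqrt (\sum_(i < n) v 0 i ^+ 2).

Definition eball (R : realType) (k : nat) (c : 'rV[R]_k) (r : R) :
  set 'rV[R]_k := [set z | enorm (z - c) < r].

Definition quad (R : realType) (n : nat) (g : 'M[R]_n) (v : 'rV[R]_n) : R :=
  (v *m g *m v^T) 0 0.

(* A point (x, y, z) of R^2 x R^k is a row vector w : 'rV_(2 + k). *)
Definition xc (R : realType) (k : nat) (w : 'rV[R]_(2 + k)) : R :=
  w 0 (lshift k 0).
Definition yc (R : realType) (k : nat) (w : 'rV[R]_(2 + k)) : R :=
  w 0 (lshift k 1).
Definition zc (R : realType) (k : nat) (w : 'rV[R]_(2 + k)) : 'rV[R]_k :=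
  rsubmx w.

Definition corner_point (R : realType) (k : nat) (z : 'rV[R]_k) :
  'rV[R]_(2 + k) := row_mx 0 z.

(* [0, eps)^2 x V *)
Definition chart (R : realType) (k : nat) (eps : R) (V : set 'rV[R]_k) :
    set 'rV[R]_(2 + k) :=
  [set w | [/\ 0 <= xc w < eps, 0 <= yc w < eps & V (zc w)]].

(* (0, eps)^2 x V *)
Definition open_chart (R : realType) (k : nat) (eps : R) (V : set 'rV[R]_k) :
    set 'rV[R]_(2 + k) :=
  [set w | [/\ 0 < xc w < eps, 0 < yc w < eps & V (zc w)]].

Definition iter_derive (R : realType) (n : nat) (f : 'rV[R]_n -> R)
    (vs : seq 'rV[R]_n) : 'rV[R]_n -> R :=
  foldr (fun v h => fun w => 'D_v h w) f vs.

(* C^oo on an open set: all iterated directional derivatives exist and are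
   continuous. *)
Definition smooth_on_open (R : realType) (n : nat) (W : set 'rV[R]_n)
    (f : 'rV[R]_n -> R) : Prop :=
  forall (vs : seq 'rV[R]_n) (w : 'rV[R]_n), W w ->
    (forall v, derivable (iter_derive f vs) w v) /\
    {for w, continuous (iter_derive f vs)}.

(* Smoothness on a subset that need not be open (here a chart with corners):
   locally the restriction of a smooth function on an open set. *)
Definition smooth_on (R : realType) (n : nat) (U : set 'rV[R]_n)
    (f : 'rV[R]_n -> R) : Prop :=
  forall w, U w -> exists W h,
    [/\ open W, W w, smooth_on_open W h &
        forall w', (W `&` U) w' -> h w' = f w'].

Definition riemannian_metric (R : realType) (n : nat) (U : set 'rV[R]_n)
    (g : 'rV[R]_n -> 'M[R]_n) : Prop :=
  [/\ forall i j, smooth_on U (fun w => g w i j),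
      forall w, U w -> (g w)^T = g w &
      forall w v, U w -> v != 0 -> 0 < quad (g w) v].

(* Borel sigma-algebra on 'rV[R]_n; R * R carries the product of the Borel
   sigma-algebras of R. *)
Definition borel_rV (R : realType) (n : nat) :=
  g_sigma_algebraType (@open 'rV[R]_n).

Definition jointly_measurable (R : realType) (n : nat) (E : set (R * R))
    (D : set 'rV[R]_n) (u : R * R -> 'rV[R]_n -> R) : Prop :=
  measurable_fun (E `*` D : set ((R * R) * borel_rV R n)%type)
    (fun q => u q.1 q.2).

Definition msupport (R : realType) (mu : set (R * R) -> \bar R) :
    set (R * R) :=
  [set a | forall W, open W -> W a -> (0 < mu W)%E].

Section weights.
Variables (R : realType) (mu : {finite_measure set (R * R)%type -> \bar R}).

Definition Fmu (k : nat) (u : R * R -> 'rV[R]_(2 + k) -> R)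
    (w : 'rV[R]_(2 + k)) : R :=
  \int[mu]_(a in msupport mu) (u a w * (xc w) `^ (- a.1) * (yc w) `^ (- a.2)).

Definition gmu (k : nat) (u : R * R -> 'rV[R]_(2 + k) -> R)
    (g0 : 'rV[R]_(2 + k) -> 'M[R]_(2 + k)) (w : 'rV[R]_(2 + k)) :
  'M[R]_(2 + k) := Fmu u w *: g0 w.

(* When the support is compact and nonempty this supremum is attained. *)
Definition Amu : R := sup [set a.1 + a.2 | a in msupport mu].

Definition Tmu (S : R) : R :=
  \int[mu]_(a in msupport mu) expR (- S * (2 - a.1 - a.2)).

Definition sqrt_Tmu_integral (S0 : R) : \bar R :=
  (\int[@lebesgue_measure R]_(S in `[S0, +oo[) (Num.sqrt (Tmu S))%:E)%E.

End weights.

Section intrinsic_geometry.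
Variables (R : realType) (n : nat).
Implicit Types (g : 'rV[R]_n -> 'M[R]_n) (D : set 'rV[R]_n)
  (c : R -> 'rV[R]_n) (s t : nat -> 'rV[R]_n).

Definition abs_continuous (a b : R) c : Prop :=
  forall e : R, 0 < e -> exists2 d : R, 0 < d &
    forall (m : nat) (l r : 'I_m -> R),
      (forall i, a <= l i /\ l i <= r i /\ r i <= b) ->
      trivIset setT (fun i => `]l i, r i[%classic) ->
      \sum_(i < m) (r i - l i) < d ->
      \sum_(i < m) enorm (c (r i) - c (l i)) < e.

(* [derive1 c t] is arbitrary where the derivative does not exist; for an
   absolutely continuous curve this is a null set. *)
Definition curve_length g (I : set R) c : \bar R :=
  (\int[@lebesgue_measure R]_(t in I)
     (Num.sqrt (quad (g (c t)) (derive1 c t)))%:E)%E.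

Definition intrinsic_dist g D (p q : 'rV[R]_n) : \bar R :=
  ereal_inf [set L | exists c : R -> 'rV[R]_n,
    [/\ abs_continuous 0 1 c, forall t : R, 0 <= t <= 1 -> D (c t),
        c 0 = p, c 1 = q & L = curve_length g `[0, 1]%classic c]].

(* The curve is parametrised by [0, 1) and tends to p at the end 1; it is
   absolutely continuous on compact subintervals. *)
Definition infinite_intrinsic_distance g D (p : 'rV[R]_n) : Prop :=
  forall c : R -> 'rV[R]_n,
    (forall b : R, 0 < b < 1 -> abs_continuous 0 b c) ->
    (forall t : R, 0 <= t < 1 -> D (c t)) ->
    c t @[t --> (1 : R)^'-] --> p ->
    curve_length g `[0, 1[%classic c = +oo%E.

Definition intrinsic_cauchy g D s : Prop :=
  (forall i, D (s i)) /\
  forall e : R, 0 < e -> exists N : nat, forall i j : nat,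
    (N <= i)%N -> (N <= j)%N -> (intrinsic_dist g D (s i) (s j) < e%:E)%E.

Definition intrinsic_equiv g D s t : Prop :=
  intrinsic_dist g D (s i) (t i) @[i --> \oo] --> 0%E.

(* The metric completion: equivalence classes of Cauchy sequences. *)
Definition completion g D : set (set (nat -> 'rV[R]_n)) :=
  [set C | exists2 s, intrinsic_cauchy g D s &
     C = [set t | intrinsic_cauchy g D t /\ intrinsic_equiv g D s t]].

Definition completion_fibre g D (p : 'rV[R]_n) :
    set (set (nat -> 'rV[R]_n)) :=
  [set C | completion g D C /\ exists2 s, C s & s @ \oo --> p].

End intrinsic_geometry.

Definition exactly_one_of_three (P Q S : Prop) : Prop :=
  [\/ [/\ P, ~ Q & ~ S], [/\ ~ P, Q & ~ S] | [/\ ~ P, ~ Q & S]].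

(* Main.v *)
(* Put T_j := T_mu(j). Since the exponents in E are nonnegative, F_mu is, up to
   constants, at least e^(2j) T_j where x, y <= e^-j and at most e^(2j) T_j
   where x, y >= e^-j.
   Lower bound: a curve along which s := x + y drops from e^-j to e^-(j+1) has
   length at least a constant times e^j sqrt(T_j) (e^-j - e^-(j+1)), so reaching
   the corner costs at least a constant times the sum of the sqrt(T_j).  This
   sum diverges together with the integral of sqrt(T_mu), and also when
   A_mu > 2, where T_mu is bounded below.
   Upper bound: if w, w' are within rho = e^-N of each other, the arc
   (1 - t) w + t w' + rho t (1 - t) (1, 1, 0) has both coordinates at least
   rho t (1 - t) and speed O(rho); cutting [0, 1] at the points e^-j and 1 - e^-j
   bounds its length by a constant times the tail of the sum beyond N.
   Finally d_mu dominates the Euclidean distance, so a Cauchy sequence equivalent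
   to one converging to p converges to p itself, and the fibre is one point.

   The coordinates of an absolutely continuous curve are differentiable almost
   everywhere and integrate their derivatives: the total variation of such a
   function is again absolutely continuous, so its Lebesgue-Stieltjes measure has
   a Radon-Nikodym density, to which Lebesgue differentiation applies. *)
Require Import Defs.
From HB Require Import structures.
From mathcomp Require Import all_boot all_order all_algebra.
From mathcomp Require Import all_classical all_reals all_analysis.
From mathcomp Require Import measurable_realfun.
From mathcomp Require Import ring lra.
Set Implicit Arguments.
Unset Strict Implicit.
Unset Printing Implicit Defensive.
Import Order.TTheory GRing.Theory Num.Theory.
Import numFieldNormedType.Exports.
Local Open Scope classical_set_scope.
Local Open Scope ring_scope.

(** * Lebesgue integrals of nonnegative functions that need not be measurable *)

(* The library integral of a nonnegative function is the supremum over simple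
   functions below it, hence meaningful without measurability; nothing is proved
   here about the measurability of the integrand of [curve_length]. *)
Section lower_integral.
Local Open Scope ereal_scope.
Context d (T : measurableType d) (R : realType).
Variable mu : {measure set T -> \bar R}.
Implicit Types (f g : T -> \bar R) (D N : set T).
Import HBNNSimple.

Lemma le_lower_integral D f g : (forall x, D x -> 0 <= f x) ->
  (forall x, D x -> f x <= g x) ->
  \int[mu]_(x in D) f x <= \int[mu]_(x in D) g x.
Proof.
move=> f0 fg; rewrite integral_mkcond [leRHS]integral_mkcond.
have f0' x : 0 <= (f \_ D) x by apply: erestrict_ge0.
have g0' x : 0 <= (g \_ D) x.
  by apply: erestrict_ge0 => y Dy; exact: le_trans (f0 _ Dy) (fg _ Dy).
rewrite !ge0_integralTE//; apply: ge_ereal_sup => _ /= [h hf <-].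
apply: ereal_sup_ubound; exists h => //= x; rewrite (le_trans (hf x))//.
by apply: lee_restrict.
Qed.

Lemma lower_integral_subset D D' f : D `<=` D' -> (forall x, D' x -> 0 <= f x) ->
  \int[mu]_(x in D) f x <= \int[mu]_(x in D') f x.
Proof.
move=> DD' f0; rewrite integral_mkcond [leRHS]integral_mkcond.
have f0' x : 0 <= (f \_ D) x.
  by apply: erestrict_ge0 => y Dy; apply: f0; exact: DD'.
apply: le_lower_integral => // x _.
rewrite !patchE; case: ifPn => [xD|_].
  by rewrite mem_set//; apply: DD'; rewrite inE in xD.
by case: ifPn => // xD'; apply: f0; rewrite inE in xD'.
Qed.

(** Only the majorant is measurable, so it is the one to change: raised to infinity on [N] it
    dominates [f] everywhere, and its integral is unaffected. *)
Lemma lower_integral_le_off_null D N f g : measurable D -> measurable N ->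
  mu N = 0 -> measurable_fun D g -> (forall x, D x -> 0 <= f x) ->
  (forall x, D x -> 0 <= g x) -> (forall x, D x -> ~ N x -> f x <= g x) ->
  \int[mu]_(x in D) f x <= \int[mu]_(x in D) g x.
Proof.
move=> mD mN N0 mg f0 g0 fg.
pose h x := if x \in N then +oo else g x.
have h0 x : D x -> 0 <= h x by move=> Dx; rewrite /h; case: ifPn => // _; exact: g0.
apply: (@le_trans _ _ (\int[mu]_(x in D) h x)).
  apply: le_lower_integral => // x Dx; rewrite /h; case: ifPn => xN.
    by rewrite leey.
  by apply: fg => //; rewrite notin_setE in xN.
have mh : measurable_fun D h.
  apply: measurable_fun_if => //.
  - apply: (measurable_fun_bool true).
    rewrite (_ : _ @^-1` _ = N); first exact: measurableI.
    by apply/seteqP; split=> x /= => [/set_mem//|Nx]; exact: mem_set.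
  - by apply: measurable_funS mg => // x [].
rewrite (ge0_negligible_integral mN mD mh h0 N0).
rewrite [leRHS](ge0_negligible_integral mN mD mg g0 N0).
rewrite le_eqVlt; apply/orP; left; apply/eqP; apply: eq_integral => x.
by rewrite inE => -[_ xN]; rewrite /h memNset.
Qed.

(** The measurable minorant loses nothing when [N] is removed from the domain, while [f], possibly
    non-measurable, is only restricted to a smaller set. *)
Lemma le_lower_integral_off_null D N f g : measurable D -> measurable N ->
  mu N = 0 -> measurable_fun D g -> (forall x, D x -> 0 <= f x) ->
  (forall x, D x -> 0 <= g x) -> (forall x, D x -> ~ N x -> g x <= f x) ->
  \int[mu]_(x in D) g x <= \int[mu]_(x in D) f x.
Proof.
move=> mD mN N0 mg f0 g0 gf; rewrite (ge0_negligible_integral mN mD mg g0 N0).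
apply: (@le_trans _ _ (\int[mu]_(x in D `\` N) f x)).
  apply: le_lower_integral => x [Dx Nx]; [exact: g0|exact: gf].
by apply: lower_integral_subset => // x [].
Qed.

(** Near-optimal simple functions for [A] and for [B] add up to a simple function below [f] on [D].
    This half of additivity needs no measurability of [f] and is the one that cuts a curve into
    pieces and bounds its length from below. *)
Lemma lower_integral_superadd D A B f : A `<=` D -> B `<=` D ->
  A `&` B = set0 -> (forall x, D x -> 0 <= f x) ->
  \int[mu]_(x in A) f x + \int[mu]_(x in B) f x <= \int[mu]_(x in D) f x.
Proof.
move=> AD BD AB f0.
(* Infinite pieces are settled by monotonicity; near-optimality up to [e] makes sense only for
   finite integrals. *)
have [fAoo|fAfin] := eqVneq (\int[mu]_(x in A) f x) +oo.
  have := lower_integral_subset AD f0; rewrite fAoo leye_eq => /eqP ->.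
  by rewrite leey.
have [fBoo|fBfin] := eqVneq (\int[mu]_(x in B) f x) +oo.
  have := lower_integral_subset BD f0; rewrite fBoo leye_eq => /eqP ->.
  by rewrite leey.
have fA0 : 0 <= \int[mu]_(x in A) f x by apply: integral_ge0 => x /AD; exact: f0.
have fB0 : 0 <= \int[mu]_(x in B) f x by apply: integral_ge0 => x /BD; exact: f0.
have finA : \int[mu]_(x in A) f x \is a fin_num by rewrite ge0_fin_numE// ltey.
have finB : \int[mu]_(x in B) f x \is a fin_num by rewrite ge0_fin_numE// ltey.
have approx C : C `<=` D -> \int[mu]_(x in C) f x \is a fin_num ->
    forall e : R, (0 < e)%R -> exists h : {nnsfun T >-> R},
    (forall x, (h x)%:E <= (f \_ C) x) /\ \int[mu]_(x in C) f x < sintegral mu h + e%:E.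
  move=> CD Cfin e e0.
  rewrite integral_mkcond ge0_integralTE in Cfin *; last first.
    by move=> x; apply: erestrict_ge0 => y /CD; exact: f0.
  have [_ /= [h hf <-] lth] := ub_ereal_sup_adherent e0 Cfin.
  by exists h; split => //; rewrite -lteBlDr.
apply/lee_addgt0Pr => e e0.
have e20 : (0 < e / 2)%R by rewrite divr_gt0.
have [hA [hAf ltA]] := approx A AD finA _ e20.
have [hB [hBf ltB]] := approx B BD finB _ e20.
apply: (@le_trans _ _ ((sintegral mu hA + (e / 2)%:E) + (sintegral mu hB + (e / 2)%:E))).
  by apply: leeD; exact: ltW.
rewrite addeACA -EFinD -splitr leeD2r// -sintegralD.
rewrite integral_mkcond ge0_integralTE; last by move=> x; exact: erestrict_ge0.
apply: ereal_sup_ubound; exists (add_nnsfun hA hB) => //= x.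
move: (hAf x) (hBf x); rewrite EFinD !patchE.
case: ifPn => [xA|xA]; case: ifPn => [xB|xB].
- by exfalso; have : (A `&` B) x by [rewrite !inE in xA xB]; rewrite AB.
- rewrite mem_set; last by apply: AD; rewrite inE in xA.
  by move=> h1 h2; rewrite -[leRHS]adde0; exact: leeD.
- rewrite mem_set; last by apply: BD; rewrite inE in xB.
  by move=> h1 h2; rewrite -[leRHS]add0e; exact: leeD.
- move=> h1 h2; apply: (@le_trans _ _ (0 + 0)); first exact: leeD.
  by rewrite adde0; case: ifPn => // xD; apply: f0; rewrite inE in xD.
Qed.

(** Off [N], the measurable series of the [c k] times the indicators of the [J k] dominates [f]. The
    [J k] may overlap: one term already suffices at each point, and the others are nonnegative. *)
Lemma lower_integral_le_step D N f (J : nat -> set T) (c l : nat -> R) :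
  measurable D -> measurable N -> mu N = 0 -> (forall k, measurable (J k)) ->
  (forall k, (0 <= c k)%R) -> (forall k, mu (J k) <= (l k)%:E) ->
  D `\` N `<=` \bigcup_k J k -> (forall x, D x -> 0 <= f x) ->
  (forall k x, D x -> J k x -> f x <= (c k)%:E) ->
  \int[mu]_(x in D) f x <= \sum_(0 <= k <oo) (c k * l k)%:E.
Proof.
move=> mD mN N0 mJ c0 Jl DJ f0 fc.
pose b k x := (c k * \1_(J k) x)%:E.
have b0 k x : 0 <= b k x by rewrite lee_fin mulr_ge0.
have mb k : measurable_fun D (b k).
  by apply/measurable_EFinP; apply: measurable_funM => //; exact: measurable_indic.
apply: (@le_trans _ _ (\int[mu]_(x in D) \sum_(0 <= k <oo) b k x)).
  apply: (lower_integral_le_off_null mD mN N0) => //.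
  - exact: ge0_emeasurable_sum.
  - by move=> x Dx; exact: nneseries_ge0.
  move=> x Dx Nx; have [k _ Jx] := DJ _ (conj Dx Nx).
  apply: (le_trans (fc _ _ Dx Jx)).
  apply: (@le_trans _ _ (b k x)); first by rewrite /b indicE mem_set// mulr1.
  rewrite (@nneseriesD1 _ (fun k => b k x) k) //.
  by rewrite leeDl//; apply: nneseries_ge0.
rewrite integral_nneseries//.
apply: lee_nneseries => [k _ _|k _].
  by apply: integral_ge0 => x _; exact: b0.
rewrite (eq_integral (fun x => (c k)%:E * (\1_(J k) x)%:E)); last first.
  by move=> x _; rewrite /b EFinM.
rewrite ge0_integralZl_EFin//; last first.
  by apply/measurable_EFinP; exact: measurable_indic.
rewrite integral_indic// EFinM; apply: lee_wpmul2l; first by rewrite lee_fin.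
apply: le_trans (Jl k); rewrite le_measure ?inE//; exact: measurableI.
Qed.

End lower_integral.

(** * Absolutely continuous functions *)

(** Families are indexed by an arbitrary finite type, so that the pieces obtained by subdividing a
    family, indexed by a dependent sum, form a family again. *)
Definition real_abs_continuous (R : realType) (a b : R) (f : R -> R) : Prop :=
  forall e : R, 0 < e -> exists2 d : R, 0 < d &
    forall (I : finType) (l r : I -> R),
      (forall i, [/\ a <= l i, l i <= r i & r i <= b]) ->
      trivIset setT (fun i => `]l i, r i[%classic) ->
      \sum_i (r i - l i) < d -> \sum_i `|f (r i) - f (l i)| < e.

Section real_abs_continuous.
Variable R : realType.
Implicit Types (a b x y : R) (f : R -> R) (s : seq R).

Lemma itv_partition_nth_homo x y s i j : itv_partition x y s ->
  (i <= j <= size s)%N -> nth y (x :: s) i <= nth y (x :: s) j.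
Proof.
move=> [ps _] /andP[ij js].
have srt : sorted <=%R (x :: s) by apply: sub_path ps => u v; exact: ltW.
by apply: (sorted_leq_nth le_trans lexx y srt) => //;
  rewrite inE/= ltnS// (leq_trans ij).
Qed.

(** Subdividing every interval of a disjoint family gives a disjoint family of the same total
    length, so the same [d] controls variations in place of increments. *)
Lemma sum_variation_lt a b f (d e : R) :
  (forall (I : finType) (l r : I -> R),
      (forall i, [/\ a <= l i, l i <= r i & r i <= b]) ->
      trivIset setT (fun i => `]l i, r i[%classic) ->
      \sum_i (r i - l i) < d -> \sum_i `|f (r i) - f (l i)| < e) ->
  forall (I : finType) (l r : I -> R) (s : I -> seq R),
    (forall i, [/\ a <= l i, l i <= r i & r i <= b]) ->
    trivIset setT (fun i => `]l i, r i[%classic) ->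
    \sum_i (r i - l i) < d ->
    (forall i, itv_partition (l i) (r i) (s i)) ->
    \sum_i variation (l i) (r i) f (s i) < e.
Proof.
move=> H I l r s lr tI ld sP.
pose J := {i : I & 'I_(size (s i))}.
pose L (p : J) := nth (r (tag p)) (l (tag p) :: s (tag p)) (tagged p).
pose U (p : J) := nth (r (tag p)) (l (tag p) :: s (tag p)) (tagged p).+1.
have lL p : l (tag p) <= L p.
  by apply: itv_partition_nth_ge => //; rewrite ltnS ltnW.
have Ur p : U p <= r (tag p).
  by apply: itv_partition_nth_le => //; rewrite ltnS.
have LU p : L p <= U p.
  by apply: itv_partition_nth_homo => //; rewrite leqnSn/=.
have lenE : \sum_p (U p - L p) = \sum_i (r i - l i).
  rewrite -(sig_big_dep xpredT (fun=> xpredT) (fun i (j : 'I_(size (s i))) =>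
    nth (r i) (l i :: s i) j.+1 - nth (r i) (l i :: s i) j)).
  apply: eq_bigr => i _; rewrite -(big_mkord xpredT (fun j =>
    nth (r i) (l i :: s i) j.+1 - nth (r i) (l i :: s i) j)) telescope_sumr//.
  by rewrite (itv_partition_nth_size _ (sP i)).
have -> : \sum_i variation (l i) (r i) f (s i) = \sum_p `|f (U p) - f (L p)|.
  rewrite -(sig_big_dep xpredT (fun=> xpredT) (fun i (j : 'I_(size (s i))) =>
    `|f (nth (r i) (l i :: s i) j.+1) - f (nth (r i) (l i :: s i) j)|)).
  by apply: eq_bigr => i _; rewrite /variation big_mkord.
apply: H; last by rewrite lenE.
  move=> p; have [al _ rb] := lr (tag p).
  by split => //; [exact: le_trans al (lL p)|exact: le_trans (Ur p) rb].
apply/trivIsetP => -[i j] [i' j'] _ _ ne.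
apply/seteqP; split => // t /= []; rewrite !in_itv/= => /andP[h1 h2] /andP[h3 h4].
have [ii'|ii'] := eqVneq i i'; last first.
  move/trivIsetP : tI => /(_ _ _ Logic.I Logic.I ii') /seteqP[+ _].
  move=> /(_ t); apply; split; rewrite /= in_itv/=; apply/andP; split.
  - exact: le_lt_trans (lL (existT _ i j)) h1.
  - exact: lt_le_trans h2 (Ur (existT _ i j)).
  - exact: le_lt_trans (lL (existT _ i' j')) h3.
  - exact: lt_le_trans h4 (Ur (existT _ i' j')).
subst i'; have jj' : j != j' by apply: contraNneq ne => ->.
(* Both pieces now belong to the same interval, where the one of smaller index ends before the other
   begins. *)
wlog lt_jj' : j j' ne h1 h2 h3 h4 jj' / (j < j')%N.
  move=> W; have [|] := ltnP j j'; first exact: W.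
  rewrite leq_eqVlt => /orP[/eqP/val_inj/esym/eqP|]; first by rewrite (negbTE jj').
  by apply: W => //; rewrite eq_sym.
have : U (existT _ i j) <= L (existT _ i j').
  by apply: itv_partition_nth_homo => //=; rewrite lt_jj'/= ltnW.
by move=> /(lt_le_trans h2) /(lt_trans h3); rewrite ltxx.
Qed.

(** With [d] answering the tolerance 1, the variation over an interval shorter than [d] is at most
    1, and finitely many steps of length [d / 2] exhaust the interval. *)
Lemma real_abs_continuous_bounded_variation a b f : a <= b ->
  real_abs_continuous a b f -> bounded_variation a b f.
Proof.
move=> ab acf; have [d d0 H] := acf 1 ltr01.
have step x y : a <= x -> x <= y -> y <= b -> y - x < d -> bounded_variation x y f.
  move=> ax xy yb yxd; exists 1 => _ [s ps <-].
  have := sum_variation_lt H (I := unit) (l := fun=> x) (r := fun=> y) (s := fun=> s).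
  rewrite !big_const !card_unit/= !addr0 => W; apply/ltW/W => //.
  by apply/trivIsetP => -[] [].
have BVn n : forall y, a <= y -> y <= b -> y <= a + n%:R * (d / 2) -> bounded_variation a y f.
  elim: n => [y ay yb|n ih y ay yb yn].
    rewrite mul0r addr0 => ya; have -> : y = a by apply/eqP; rewrite eq_le ya ay.
    exact: bounded_variationxx.
  pose x := Num.max a (y - d / 2).
  have ax : a <= x by rewrite le_max lexx.
  have xy : x <= y by rewrite ge_max ay/= gerBl divr_ge0// ltW.
  have xb : x <= b by exact: le_trans yb.
  apply/bounded_variationP => //.
  rewrite (total_variationD _ ax xy) fin_numD; apply/andP; split.
    apply/bounded_variationP => //; apply: ih => //.
    rewrite ge_max lerDl mulr_ge0 ?divr_ge0//=; last exact: ltW.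
    by move: yn; rewrite -natr1 mulrDl mul1r addrA lerBlDr.
  apply/bounded_variationP => //; apply: step => //.
  have : y - d / 2 <= x by rewrite le_max lexx orbT.
  by lra.
apply: (BVn (Num.truncn ((b - a) / (d / 2))).+1) => //.
rewrite -lerBlDl -ler_pdivrMr ?divr_gt0//.
exact/ltW/truncnS_gt.
Qed.

(** An increment of the variation function is the total variation over that interval, which some
    partition nearly attains; [sum_variation_lt] then applies. *)
Lemma real_abs_continuous_total_variation a b f : a <= b ->
  real_abs_continuous a b f ->
  real_abs_continuous a b (fine \o total_variation a ^~ f).
Proof.
move=> ab acf e e0.
have bvf := real_abs_continuous_bounded_variation ab acf.
have bvxy x y : a <= x -> x <= y -> y <= b -> total_variation x y f \is a fin_num.
  move=> ax xy yb; apply/bounded_variationP => //.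
  apply: (@bounded_variationl _ _ _ b) => //.
  by apply: (@bounded_variationr _ a) => //; exact: le_trans yb.
have e20 : 0 < e / 2 by rewrite divr_gt0.
have [d d0 H] := acf _ e20; exists d => // I l r lr tI ld.
have TVE i : (fine \o total_variation a ^~ f) (r i) -
    (fine \o total_variation a ^~ f) (l i) = fine (total_variation (l i) (r i) f).
  have [al lri rb] := lr i.
  rewrite /= (total_variationD f al lri) fineD.
  - by rewrite addrC addKr.
  - by apply: bvxy => //; exact: le_trans rb.
  - exact: bvxy.
(* The errors of all the intervals together stay within [e / 2]; the successor avoids a division by
   zero for an empty family. *)
pose eta := e / 2 / #|I|.+1%:R.
have eta0 : 0 < eta by rewrite divr_gt0.
have /choice[s sP] i : exists s, itv_partition (l i) (r i) s /\
    fine (total_variation (l i) (r i) f) <= variation (l i) (r i) f s + eta.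
  have [al lri rb] := lr i.
  have fin := bvxy _ _ al lri rb.
  have [_ [_ [s ps <-] <-] h] := ub_ereal_sup_adherent eta0 fin.
  exists s; split => //; apply: ltW.
  by rewrite -lte_fin EFinD fineK// -lteBlDr.
rewrite (eq_bigr (fun i => fine (total_variation (l i) (r i) f))); last first.
  move=> i _; have [_ lri _] := lr i.
  by rewrite TVE ger0_norm// fine_ge0// total_variation_ge0.
have := sum_variation_lt H lr tI ld (fun i => (sP i).1) => sv.
apply: (@le_lt_trans _ _ (\sum_i (variation (l i) (r i) f (s i) + eta))).
  by apply: ler_sum => i _; have [] := sP i.
rewrite big_split/= sumr_const (splitr e) ltr_leD//.
rewrite -[leLHS]mulr_natr /eta -mulrA ger_pMr//.
by rewrite mulrC ler_pdivrMr// mul1r ler_nat.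
Qed.

End real_abs_continuous.

(** * Densities of absolutely continuous functions *)

Section nondecreasing_density.
Variable R : realType.
Implicit Types (a b x y : R) (f w : R -> R).
Local Notation mu := (@lebesgue_measure R).

(** Openness keeps the endpoints of the hull out of [J], finite measure rules out unbounded hulls,
    and the empty set is the degenerate ]0, 0[. *)
Lemma open_bounded_interval (J : set R) : open J -> is_interval J ->
  (mu J < +oo)%E -> exists l r : R, l <= r /\ J = `]l, r[%classic.
Proof.
move=> oJ iJ.
have [->|/set0P[t0 Jt0]] := eqVneq J set0.
  by exists 0, 0; split => //; rewrite set_itv_ge// bnd_simp ltxx.
have opn (t : R) : J t -> exists2 e : R, 0 < e & J (t - e) /\ J (t + e).
  move=> Jt; have /nbhs_ballP[e /= e0 be] : nbhs t J by exact: open_nbhs_nbhs.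
  exists (e / 2); first by rewrite divr_gt0.
  have e2 : `|e / 2| < e.
    by rewrite gtr0_norm ?divr_gt0// ltr_pdivrMr// ltr_pMr// ltr1n.
  split; apply: be; rewrite /ball/=; first by rewrite opprB addrC subrK.
  by rewrite opprD addrA subrr add0r normrN.
have JE : J = [set` Rhull J] by rewrite RhullK// inE.
rewrite {1}JE lebesgue_measure_itv.
case: (Rhull J) JE => -[b1 l|[]] [b2 r|[]] JE /=; last first.
- by move: Jt0; rewrite JE.
- by move: Jt0; rewrite JE.
- by move: Jt0; rewrite JE.
- by [].
- by move: Jt0; rewrite JE set_itvE.
- by rewrite ltNyr.
- by rewrite ltry.
- by move: Jt0; rewrite JE set_itvE.
move=> _.
have lJr t : J t -> l < t < r.
  move=> Jt; have [e e0 []] := opn _ Jt.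
  rewrite JE /= !in_itv/= => /andP[h1 _] /andP[_ h2].
  have {}h1 : l <= t - e by case: (b1) h1 => // /ltW.
  have {}h2 : t + e <= r by case: (b2) h2 => // /ltW.
  by apply/andP; split; lra.
exists l, r; split; first by have := lJr _ Jt0; lra.
apply/seteqP; split => [t /lJr|t]; first by rewrite /= in_itv.
rewrite JE /= !in_itv/= => /andP[h1 h2].
by apply/andP; split; [case: (b1)|case: (b2)] => //=; exact: ltW.
Qed.

Lemma real_abs_continuous_within a b f : real_abs_continuous a b f ->
  forall e : R, 0 < e -> exists2 d : R, 0 < d & forall x y : R,
    a <= x <= b -> a <= y <= b -> `|x - y| < d -> `|f x - f y| < e.
Proof.
move=> acf e e0; have [d d0 H] := acf e e0; exists d => // x y.
wlog xy : x y / x <= y.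
  move=> W; have [|/ltW yx ? ? ?] := leP x y; first exact: W.
  by rewrite distrC; apply: W => //; rewrite distrC.
move=> /andP[ax xb] /andP[ay yb]; rewrite distrC ger0_norm ?subr_ge0// => yx.
have := H unit (fun=> x) (fun=> y).
rewrite !big_const !card_unit/= !addr0 distrC; apply => //.
by apply/trivIsetP => -[] [].
Qed.

(** The retraction of the line onto [a, b]. Composing with it extends a function by constants, since
    a Stieltjes measure needs a function on the whole line. *)
Let clamp a b x := Num.min b (Num.max a x).

Let clamp_bounds a b x : a <= b -> a <= clamp a b x <= b.
Proof. by move=> ab; rewrite le_min ab le_max lexx ge_min lexx. Qed.

Let clamp_id a b x : a <= x <= b -> clamp a b x = x.
Proof. by move=> /andP[ax xb]; rewrite /clamp max_r// min_r. Qed.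

Let clamp_homo a b x y : x <= y -> clamp a b x <= clamp a b y.
Proof.
by move=> xy; rewrite /clamp /Num.min /Num.max; repeat case: ifPn; rewrite -?leNgt; lra.
Qed.

Let clamp_lip a b x y : a <= b -> x <= y -> clamp a b y - clamp a b x <= y - x.
Proof.
by move=> ab xy; rewrite /clamp /Num.min /Num.max; repeat case: ifPn; rewrite -?leNgt; lra.
Qed.

Let clamp_sub a b x y t : a <= b -> clamp a b x < t < clamp a b y -> x < t < y.
Proof.
by move=> ab; rewrite /clamp /Num.min /Num.max; repeat case: ifPn; rewrite -?leNgt; lra.
Qed.

(** The Stieltjes measure of the extended [w], cut down to ]a, b], is finite and absolutely
    continuous with respect to Lebesgue measure; [h] is its Radon-Nikodym density. *)
Lemma nondecreasing_density a b w : a <= b ->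
  {in `[a, b] &, {homo w : x y / x <= y}} -> real_abs_continuous a b w ->
  exists h : R -> R, mu.-integrable setT (EFin \o h) /\
    forall x, a <= x <= b ->
      (\int[mu]_(t in `]a, x]) (h t)%:E = (w x - w a)%:E)%E.
Proof.
move=> ab wh acw.
pose W x := w (clamp a b x).
have Wnd : nondecreasing W.
  by move=> x y xy; apply: wh; rewrite ?in_itv/= ?clamp_bounds//; exact: clamp_homo.
have Wrc : right_continuous W.
  apply: right_continuousW => x; apply/cvgrPdist_lt => e e0.
  have [d d0 H] := real_abs_continuous_within acw e0.
  near=> y; apply: H; rewrite ?clamp_bounds//.
  have : `|x - y| < d by near: y; exact: cvgr_dist_lt.
  apply: le_lt_trans; have [xy|/ltW yx] := leP x y.
    rewrite distrC (distrC x) !ger0_norm ?subr_ge0 ?clamp_homo//.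
    exact: clamp_lip.
  by rewrite !ger0_norm ?subr_ge0 ?clamp_homo//; exact: clamp_lip.
pose Wc : cumulative R R := HB.pack W (isCumulative.Build _ _ _ W Wnd Wrc).
pose nu0 : {measure set (measurableTypeR R) -> \bar R} :=
  lebesgue_stieltjes_measure Wc.
have nu0oc x y : x <= y -> nu0 `]x, y]%classic = (W y - W x)%:E.
  move=> xy; rewrite /nu0/= /lebesgue_stieltjes_measure.
  rewrite /measure_extension measurable_mu_extE/=; last exact: is_ocitv.
  by rewrite wlength_itv_bnd.
have mab : measurable (`]a, b]%classic : set (measurableTypeR R)) by [].
have nuab : (nu0 `]a, b]%classic < +oo)%E by rewrite nu0oc// ltry.
pose nu : {finite_measure set (measurableTypeR R) -> \bar R} :=
  mfrestr mab nuab.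
(* A null set lies in an open set of measure below [d]; that set is a disjoint union of open
   intervals, on which absolute continuity bounds the increments of [w]. *)
have numu : nu `<< mu.
  apply/null_content_dominatesP => A mA muA.
  apply/eqP; rewrite -measure_le0; apply/lee_addgt0Pr => e e0; rewrite add0e.
  have [d d0 H] := acw e e0.
  have muAoo : (mu A < +oo)%E by rewrite (muA : mu A = 0%E).
  have [U [oU AU UAd]] := lebesgue_regularity_outer mA muAoo d0.
  have mU : measurable U by exact: open_measurable.
  have muU : (mu U < d%:E)%E.
    rewrite -(setDKU AU) measureU//; last 2 first.
    - exact: measurableD.
    - by rewrite setDKI.
    by rewrite [X in (_ + X)%E](_ : _ = 0%E)// adde0.
  have [J [oiJ tJ UJ]] := OpenSetDisjointItvs.open_disjoint_itv oU.
  have mJ k : measurable (J k) by apply: open_measurable; have [] := oiJ k.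
  have JU k : J k `<=` U by rewrite UJ; exact: bigcup_sup.
  have /choice[lr lrP] k : exists z : R * R, z.1 <= z.2 /\ J k = `]z.1, z.2[%classic.
    have [oJ iJ] := oiJ k.
    have [|l [r ?]] := open_bounded_interval oJ iJ; last by exists (l, r).
    apply: le_lt_trans (lt_trans muU (ltry _)).
    by apply: le_measure; rewrite ?inE//; exact: mJ.
  apply: (@le_trans _ _ (nu0 U)).
    rewrite /nu/= /mfrestr/= /mrestr; rewrite le_measure ?inE//.
      exact: measurableI.
    exact: subset_trans AU.
  apply: (@le_trans _ _ (\sum_(0 <= k <oo) nu0 (J k))%E).
    by rewrite UJ; apply: measure_sigma_subadditive => //; exact: bigcupT_measurable.
  (* Absolute continuity speaks of finite families only, so the bound is proved for each partial
     sum. *)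
  apply: lime_le; first exact: is_cvg_nneseries.
  near=> n; rewrite big_mkord.
  apply: (@le_trans _ _ (\sum_(k < n) (W (lr k).2 - W (lr k).1)%:E)%E).
    apply: lee_sum => k _; have [lrk JE] := lrP k.
    rewrite -nu0oc//; apply: le_measure; rewrite ?inE//; first exact: mJ.
    by rewrite JE; apply: subset_itvl; rewrite bnd_simp.
  rewrite sumEFin lee_fin; apply: ltW.
  rewrite (eq_bigr (fun k : 'I_n => `|W (lr k).2 - W (lr k).1|)); last first.
    by move=> k _; have [lrk _] := lrP k; rewrite ger0_norm// subr_ge0; exact: (Wnd).
  (* The intervals may stick out of [a, b]; the hypothesis is applied to their clamped endpoints. *)
  apply: H.
  - move=> k; have [lrk _] := lrP k.
    have := clamp_bounds (lr k).1 ab; have := clamp_bounds (lr k).2 ab.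
    by move=> /andP[? ?] /andP[? ?]; split => //; exact: clamp_homo.
  - apply/trivIsetP => i j _ _ ij.
    move/trivIsetP : tJ => /(_ i j Logic.I Logic.I ij).
    apply: subsetI_eq0 => t /=; rewrite in_itv/= => /(clamp_sub ab);
    by [rewrite (lrP i).2 /= in_itv|rewrite (lrP j).2 /= in_itv].
  - apply: (@le_lt_trans _ _ (\sum_(k < n) ((lr k).2 - (lr k).1))).
      by apply: ler_sum => k _; apply: clamp_lip => //; have [] := lrP k.
    rewrite -lte_fin -sumEFin; apply: le_lt_trans muU.
    rewrite [in leRHS]UJ measure_bigcup//; last by move=> k _; exact: mJ.
    apply: (@le_trans _ _ (\sum_(0 <= k < n) mu (J k))%E); last first.
      rewrite (@eq_eseriesl _ _ xpredT)//; first exact: nneseries_lim_ge.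
      by move=> k; rewrite in_setT.
    rewrite big_mkord; apply: lee_sum => k _.
    have [lrk ->] := lrP k.
    rewrite lebesgue_measure_itv/= lte_fin.
    by case: ltgtP lrk => // -> _; rewrite subrr.
have [g [g0 gfin intg gE]] := @radon_nikodym_sigma_finite _ _ R mu nu numu.
exists (fine \o g); split.
  by apply: eq_integrable intg => // x _; rewrite /= fineK.
move=> x /andP[ax xb].
transitivity (nu `]a, x]%classic).
  by rewrite gE//; apply: eq_integral => t _; rewrite /= fineK.
rewrite /nu/= /mfrestr /mrestr setIidl; last by apply: subset_itvl; rewrite bnd_simp.
by rewrite [LHS]nu0oc// /W !clamp_id// ?lexx ?ax.
Unshelve. all: by end_near. Qed.

End nondecreasing_density.

Section density.
Variable R : realType.
Implicit Types (a b x y : R) (f : R -> R).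
Local Notation mu := (@lebesgue_measure R).

Lemma real_abs_continuousB a b f g : real_abs_continuous a b f ->
  real_abs_continuous a b g -> real_abs_continuous a b (f \- g).
Proof.
move=> acf acg e e0; have e20 : 0 < e / 2 by rewrite divr_gt0.
have [d1 d10 H1] := acf _ e20; have [d2 d20 H2] := acg _ e20.
exists (Num.min d1 d2); first by rewrite lt_min d10.
move=> I l r lr tI; rewrite lt_min => /andP[/(H1 _ _ _ lr tI) h1 /(H2 _ _ _ lr tI) h2].
rewrite (splitr e); apply: le_lt_trans (ltrD h1 h2); rewrite -big_split/=.
apply: ler_sum => i _.
have -> : (f \- g) (r i) - (f \- g) (l i) =
    (f (r i) - f (l i)) - (g (r i) - g (l i)).
  by rewrite /=; ring.
exact: ler_normB.
Qed.

(** Jordan decomposition: [f] is the difference of [v] and [v \- f], both nondecreasing and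
    absolutely continuous, so the density is the difference of theirs. *)
Lemma real_abs_continuous_density a b f : a <= b ->
  real_abs_continuous a b f ->
  exists h : R -> R, [/\ mu.-integrable setT (EFin \o h),
    forall x, a <= x <= b ->
      (\int[mu]_(t in `]a, x]) (h t)%:E = (f x - f a)%:E)%E &
    {ae mu, forall x, a < x < b -> derive1 f x = h x /\ derivable f x 1}].
Proof.
move=> ab acf; pose v := fine \o total_variation a ^~ f.
have acv : real_abs_continuous a b v by exact: real_abs_continuous_total_variation.
have bvf := real_abs_continuous_bounded_variation ab acf.
have fin x y : a <= x -> x <= y -> y <= b -> total_variation x y f \is a fin_num.
  move=> ax xy yb; apply/bounded_variationP => //.
  apply: (@bounded_variationl _ _ _ b) => //.
  by apply: (@bounded_variationr _ a) => //; exact: le_trans yb.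
have vE x y : a <= x -> x <= y -> y <= b ->
    v y - v x = fine (total_variation x y f).
  move=> ax xy yb; rewrite /v /= (total_variationD f ax xy) fineD; last 2 first.
  - by apply: fin => //; exact: le_trans yb.
  - exact: fin.
  by rewrite addrC addKr.
have vnd : {in `[a, b] &, {homo v : x y / x <= y}}.
  move=> x y; rewrite !in_itv/= => /andP[ax _] /andP[_ yb] xy.
  by rewrite -subr_ge0 vE// fine_ge0// total_variation_ge0.
have vfnd : {in `[a, b] &, {homo (v \- f) : x y / x <= y}}.
  move=> x y; rewrite !in_itv/= => /andP[ax _] /andP[_ yb] xy.
  rewrite -subr_ge0.
  have -> : (v \- f) y - (v \- f) x = (v y - v x) - (f y - f x).
    by rewrite /=; ring.
  rewrite subr_ge0 vE// -lee_fin fineK ?fin//.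
  by apply: le_trans (total_variation_ge f xy); rewrite lee_fin ler_norm.
have [h1 [i1 E1]] := nondecreasing_density ab vnd acv.
have [h2 [i2 E2]] := nondecreasing_density ab vfnd (real_abs_continuousB acv acf).
have ih : mu.-integrable setT (EFin \o (h1 \- h2)).
  rewrite (_ : _ \o _ = (EFin \o h1) \- (EFin \o h2))%E; first exact: integrableB.
  by apply/funext => t.
have hE x : a <= x <= b -> (\int[mu]_(t in `]a, x]) ((h1 \- h2) t)%:E = (f x - f a)%:E)%E.
  move=> axb; transitivity (\int[mu]_(t in `]a, x]) ((EFin \o h1) \- (EFin \o h2))%E t)%E.
    exact: eq_integral.
  rewrite integralB//; [|exact: integrableS i1|exact: integrableS i2].
  rewrite E1// E2// -EFinB; congr EFin.
  by rewrite /=; ring.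
exists (h1 \- h2); split => //.
have := @FTC1 _ (h1 \- h2) (BRight a).
have iy y : mu.-integrable [set` Interval (BRight a) (BRight y)] (EFin \o (h1 \- h2)).
  exact: integrableS ih.
move=> /(_ iy (open_integrable_locally openT ih)).
apply: filterS; first exact: (ae_filter_ringOfSetsType mu).
move=> x H /andP[ax xb].
have [|dF F'] := H; first exact: ax.
(* Lebesgue differentiation concerns the primitive of the density; near an interior point [f] equals
   that primitive up to the constant [f a], so the derivative transfers. *)
have nE : {near x, (fun y => f a +
    \int[mu]_(t in [set` Interval (BRight a) (BRight y)]) (h1 \- h2) t) =1 f}.
  near=> y; rewrite /Rintegral.
  rewrite [X in fine X](_ : _ = (f y - f a)%:E) /=; first by rewrite addrC subrK.
  rewrite -hE//; apply/andP; split; apply: ltW; near: y.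
    exact: lt_nbhsr.
  exact: lt_nbhsl.
have dc : derivable (fun y => f a +
    \int[mu]_(t in [set` Interval (BRight a) (BRight y)]) (h1 \- h2) t) x 1.
  by apply: derivableD.
split; last exact: near_eq_derivable dc.
rewrite -F' !derive1E -(near_eq_derive _ nE).
by rewrite deriveD// derive_cst add0r.
Unshelve. all: by end_near. Qed.

End density.

(** * The Euclidean norm against coordinates *)

Section enorm.
Variables (R : realType) (n : nat).
Implicit Types v w : 'rV[R]_n.

Lemma enorm_ge0 v : 0 <= enorm v.
Proof. exact: sqrtr_ge0. Qed.

Lemma sqr_enorm v : enorm v ^+ 2 = \sum_(i < n) v 0 i ^+ 2.
Proof. by rewrite sqr_sqrtr// sumr_ge0// => i _; exact: sqr_ge0. Qed.

Lemma coord_le_enorm v i : `|v 0 i| <= enorm v.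
Proof.
rewrite -(sqrtr_sqr (v 0 i)) ler_wsqrtr// (bigD1 i)//= lerDl.
by apply: sumr_ge0 => j _; exact: sqr_ge0.
Qed.

Lemma enorm_le v (M : R) : 0 <= M -> (forall i, `|v 0 i| <= M) ->
  enorm v <= Num.sqrt n%:R * M.
Proof.
move=> M0 vM; rewrite -(ger0_norm M0) -sqrtr_sqr -sqrtrM//.
rewrite ler_wsqrtr// mulr_natl -[n in leRHS]card_ord -sumr_const ler_sum// => i _.
by rewrite -real_normK ?num_real// lerXn2r// nnegrE.
Qed.

End enorm.

(** * Derivatives and lengths of absolutely continuous curves *)

Section curve_length.
Variables (R : realType) (n : nat).
Implicit Types (a b x : R) (c : R -> 'rV[R]_n) (g : 'rV[R]_n -> 'M[R]_n)
  (v : 'rV[R]_n).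
Local Notation mu := (@lebesgue_measure R).

Lemma abs_continuous_coord a b c i : abs_continuous a b c ->
  real_abs_continuous a b (fun t => c t 0 i).
Proof.
move=> acc e /acc[d d0 H]; exists d => // I l r lr tI.
(* Absolute continuity of curves is stated for families indexed by ordinals, so the finite type [I]
   is enumerated. *)
rewrite (reindex (@enum_val I predT))/=; last first.
  by apply: onW_bij; exact: enum_val_bij.
rewrite [X in _ -> X < _](reindex (@enum_val I predT))/=; last first.
  by apply: onW_bij; exact: enum_val_bij.
move=> ld; apply: (@le_lt_trans _ _ (\sum_(j < #|I|)
    enorm (c (r (enum_val j)) - c (l (enum_val j))))).
  apply: ler_sum => j _; apply: le_trans (coord_le_enorm _ i).
  by rewrite !mxE.
apply: H => //.
  by move=> j; have [? ? ?] := lr (enum_val j).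
apply/trivIsetP => j k _ _ jk; move/trivIsetP : tI; apply => //.
by apply: contra jk => /eqP/enum_val_inj->.
Qed.

(** The finitely many coordinates share one exceptional null set. Off it the vector derivative
    exists and is computed coordinatewise, so [derive1] does not take its default value. *)
Lemma abs_continuous_density a b c : a <= b -> abs_continuous a b c ->
  exists h : R -> 'rV[R]_n,
  [/\ forall i, mu.-integrable setT (fun t => (h t 0 i)%:E),
    forall i x, a <= x <= b ->
      (\int[mu]_(t in `]a, x]) (h t 0 i)%:E = (c x 0 i - c a 0 i)%:E)%E &
    exists N, [/\ measurable N, mu N = 0%E &
      forall t, a < t < b -> ~ N t -> derive1 c t = h t]].
Proof.
move=> ab acc.
have /choice[h hP] i := real_abs_continuous_density ab (abs_continuous_coord i acc).
exists (fun t => \row_i h i t); split.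
- move=> i; have [ih _ _] := hP i.
  by apply: eq_integrable ih => // t _; rewrite /= mxE.
- move=> i x axb; have [_ hE _] := hP i; rewrite -hE//.
  by apply: eq_integral => t _; rewrite mxE.
have : {ae mu, forall t, forall i, a < t < b ->
    derive1 (fun t => c t 0 i) t = h i t /\ derivable (fun t => c t 0 i) t 1}.
  have fl := ae_filter_ringOfSetsType mu; apply: filter_forall.
  by move=> i; have [] := hP i.
move=> [N [mN N0 sN]]; exists N; split => // t tab Nt.
have NP i : derive1 (fun t => c t 0 i) t = h i t /\ derivable (fun t => c t 0 i) t 1.
  by apply: contrapT => H; apply: Nt; apply: sN => /= /(_ i tab).
have dc : derivable c t 1.
  apply/derivable_mxP => i j; rewrite (ord1 i).
  by have [] := NP j.
rewrite derive1E derive_mx//; apply/rowP => i; rewrite !mxE -derive1E.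
by have [] := NP i.
Qed.

Lemma curve_length_ge0 g c (I : set R) : (0 <= curve_length g I c)%E.
Proof. by apply: integral_ge0 => t _; rewrite lee_fin sqrtr_ge0. Qed.

(** The linear form with coefficients [q] integrates its derivative along the curve, so its
    increment is at most the integral of the absolute value of that derivative, which the length
    integrand dominates up to [k]. *)
Lemma curve_length_ge g c a b (q : 'I_n -> R) (k : R) : a <= b -> 0 <= k ->
  abs_continuous a b c ->
  (forall t v, a <= t <= b ->
     k * `|\sum_i q i * v 0 i| <= Num.sqrt (quad (g (c t)) v)) ->
  ((k * `|\sum_i q i * (c b 0 i - c a 0 i)|)%:E <=
    curve_length g `]a, b]%classic c)%E.
Proof.
move=> ab k0 acc kg.
have [h [ih hE [N [mN N0 cN]]]] := abs_continuous_density ab acc.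
pose H t := \sum_i q i * h t 0 i.
have iH : mu.-integrable setT (EFin \o H).
  rewrite (_ : _ \o _ = (fun t => \sum_i (q i)%:E * (h t 0 i)%:E)%E); last first.
    by apply/funext => t; rewrite /= -sumEFin.
  by apply: integrable_sum => // i _; exact: integrableZl.
have iHab : mu.-integrable `]a, b] (EFin \o H) by exact: integrableS iH.
have HE : (\int[mu]_(t in `]a, b]) (H t)%:E =
    (\sum_i q i * (c b 0 i - c a 0 i))%:E)%E.
  rewrite (_ : (fun t => (H t)%:E) = (fun t => \sum_i (q i)%:E * (h t 0 i)%:E)%E); last first.
    by apply/funext => t; rewrite /= -sumEFin.
  have ihi i : mu.-integrable `]a, b] (fun t => (h t 0 i)%:E) by exact: integrableS (ih i).
  rewrite integral_sum//; last by move=> i; exact: integrableZl.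
  rewrite -sumEFin; apply: eq_bigr => i _.
  by rewrite integralZl// hE ?lexx ?ab.
have mHn : measurable_fun `]a, b] (fun t => (`|H t|)%:E).
  apply/measurable_EFinP/measurableT_comp => //.
  by apply/measurable_EFinP; exact: measurable_int iHab.
apply: (@le_trans _ _ (\int[mu]_(t in `]a, b]) (k * `|H t|)%:E)%E).
  under eq_integral do rewrite EFinM.
  rewrite ge0_integralZl_EFin// EFinM lee_wpmul2l ?lee_fin//.
  rewrite -abse_EFin -HE; apply: le_trans (le_abse_integral _ _ _) _ => //.
  exact: measurable_int iHab.
(* The density is identified with the derivative on the open interval only, so the endpoint [b]
   joins the null set. *)
apply: (@le_lower_integral_off_null _ _ _ mu `]a, b]%classic (N `|` [set b])) => //.
- by apply: measurableU.
- by rewrite measureU0//; exact: lebesgue_measure_set1.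
- by apply/measurable_EFinP/measurable_funM => //; exact/measurable_EFinP.
- by move=> t _; rewrite lee_fin mulr_ge0.
- move=> t /=; rewrite in_itv/= => /andP[at_ tb] /not_orP[Nt tNb].
  have tb' : t < b by rewrite lt_neqAle tb andbT; apply/eqP.
  rewrite lee_fin cN ?at_//; apply: kg.
  by rewrite (ltW at_) tb.
Qed.

End curve_length.

(** * The weight measure *)

Section rational_boxes.
Variable R : realType.

(** Squares with rational centre and radius form a countable base of the plane. *)
Definition rat_box (z : rat * rat * rat) : set (R * R) :=
  ball (ratr z.1.1 : R) (ratr z.2) `*` ball (ratr z.1.2 : R) (ratr z.2).

Lemma open_rat_box z : open (rat_box z).
Proof.
rewrite openE => -[a b] [/= za zb].
exists (ball (ratr z.1.1 : R) (ratr z.2), ball (ratr z.1.2 : R) (ratr z.2)) => //=.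
by split; apply: open_nbhs_nbhs; split => //; exact: ball_open.
Qed.

Lemma measurable_rat_box z : measurable (rat_box z).
Proof. by apply: measurableX; exact: measurable_ball. Qed.

Lemma nbhs_rat_box (W : set (R * R)) a : open W -> W a ->
  exists2 z, rat_box z a & rat_box z `<=` W.
Proof.
move=> oW Wa; have /nbhs_ballP[e /= e0 be] : nbhs a W by exact: open_nbhs_nbhs.
have [r] := @rat_in_itvoo _ (0 : R) (e / 2) (divr_gt0 e0 (ltr0Sn _ 1)).
rewrite in_itv/= => /andP[r0 re].
have appr (t : R) : exists q : rat, `|ratr q - t| < ratr r.
  have [|q] := @rat_in_itvoo _ t (t + ratr r); first by rewrite ltrDl.
  rewrite in_itv/= => /andP[tq qt]; exists q.
  by rewrite gtr0_norm ?subr_gt0// ltrBlDl.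
have [q1 q1a] := appr a.1; have [q2 q2a] := appr a.2.
exists (q1, q2, r); first by split.
have tri (q t t' : R) : `|q - t| < ratr r -> `|q - t'| < ratr r -> `|t - t'| < e.
  move=> h1 h2; rewrite -(subrKA q) (le_lt_trans (ler_normD _ _))// (distrC t).
  by rewrite (splitr e) ltrD// (lt_trans _ re).
move=> p [/= p1 p2]; apply: be; split => /=.
  exact: tri q1a p1.
exact: tri q2a p2.
Qed.

(** Codes of no box, or of a box failing [P], give the empty set, so that unions and sums run over
    all natural numbers. *)
Definition nth_rat_box (P : set (R * R) -> Prop) (n : nat) : set (R * R) :=
  if unpickle n is Some z then
    if `[< P (rat_box z) >] then rat_box z else set0
  else set0.

Lemma bigcup_nth_rat_boxP P a : (\bigcup_n nth_rat_box P n) a <->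
  exists2 z, rat_box z a & P (rat_box z).
Proof.
split.
  move=> [n _]; rewrite /nth_rat_box; case: unpickle => // z.
  by case: asboolP => // Pz za; exists z.
move=> [z za Pz].
have [n nz] : exists n, unpickle n = Some z by exists (pickle z); exact: pickleK.
by exists n; [exact: Logic.I|rewrite /nth_rat_box nz asboolT].
Qed.

Lemma measurable_nth_rat_box P n : measurable (nth_rat_box P n).
Proof.
rewrite /nth_rat_box; case: unpickle => // z.
by case: ifPn => // _; exact: measurable_rat_box.
Qed.

(** The sigma-algebra is the product one, generated by rectangles; an open set is the countable
    union of the rational boxes inside it. *)
Lemma open_measurable_plane (W : set (R * R)) : open W -> measurable W.
Proof.
move=> oW; rewrite (_ : W = \bigcup_n nth_rat_box (fun B => B `<=` W) n).
  by apply: bigcupT_measurable => n; exact: measurable_nth_rat_box.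
apply/seteqP; split => a.
  by move=> Wa; apply/bigcup_nth_rat_boxP; exact: nbhs_rat_box.
by move=> /bigcup_nth_rat_boxP[z za]; exact.
Qed.

Variable mu : {finite_measure set (R * R)%type -> \bar R}.

(** A point outside the support has a null open neighbourhood, hence lies in a null rational box.
    Being a countable union, the complement is measurable and null. *)
Lemma setC_msupportE : ~` msupport mu = \bigcup_n nth_rat_box (fun B => mu B = 0%E) n.
Proof.
apply/seteqP; split => a.
  move=> /existsNP[W /not_implyP[oW /not_implyP[Wa /negP]]].
  rewrite -leNgt measure_le0 => /eqP W0.
  have [z za zW] := nbhs_rat_box oW Wa.
  apply/bigcup_nth_rat_boxP; exists z => //.
  apply/eqP; rewrite -measure_le0 -W0 le_measure ?inE//.
    exact: measurable_rat_box.
  exact: open_measurable_plane.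
move=> /bigcup_nth_rat_boxP[z za z0] /(_ _ (@open_rat_box z) za).
by rewrite z0 ltxx.
Qed.

Lemma measurable_msupport : measurable (msupport mu).
Proof.
rewrite -[msupport mu]setCK setC_msupportE; apply: measurableC.
by apply: bigcupT_measurable => n; exact: measurable_nth_rat_box.
Qed.

Lemma measure_setC_msupport : mu (~` msupport mu) = 0%E.
Proof.
rewrite setC_msupportE; apply/eqP; rewrite -measure_le0.
apply: (@le_trans _ _ (\sum_(0 <= n <oo)
    mu (nth_rat_box (fun B => mu B = 0%E) n))%E).
  apply: measure_sigma_subadditive => //.
  - by move=> n; exact: measurable_nth_rat_box.
  - by apply: bigcupT_measurable => n; exact: measurable_nth_rat_box.
rewrite eseries0// => n _ _; rewrite /nth_rat_box.
case: unpickle => [z|]; last by rewrite measure0.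
by case: asboolP => // _; rewrite measure0.
Qed.

Lemma measureI_msupport W : measurable W -> mu (msupport mu `&` W) = mu W.
Proof.
move=> mW; have mE := measurable_msupport.
have -> : mu W = (mu (W `\` msupport mu) + mu (W `&` msupport mu))%E.
  exact: measureDI.
have -> : mu (W `\` msupport mu) = 0%E; last by rewrite add0e setIC.
apply/eqP; rewrite -measure_le0 -measure_setC_msupport le_measure ?inE//.
- exact: measurableD.
- exact: measurableC.
Qed.

End rational_boxes.

(** * Exponential integrals against the weight measure and the behaviour of [Tmu] *)

Section weight_integrals.
Variables (R : realType) (mu : {finite_measure set (R * R)%type -> \bar R}).
Hypothesis cE : compact (msupport mu).
Hypothesis E0 : forall a, msupport mu a -> 0 <= a.1 /\ 0 <= a.2.
Hypothesis muT : mu setT != 0%E.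

Let E := msupport mu.
Let mE : measurable E. Proof. exact: measurable_msupport. Qed.

Lemma measure_msupport_gt0 : (0 < mu E)%E.
Proof. by rewrite -[E]setIT measureI_msupport// lt0e muT measure_ge0. Qed.

Lemma msupport_bounded : exists2 M : R, 0 < M &
  forall a, E a -> [/\ 0 <= a.1, 0 <= a.2, a.1 <= M & a.2 <= M].
Proof.
have [M [Mreal HM]] := compact_bounded cE.
exists (Num.max 0 M + 1); first by rewrite ltr_wpDl// le_max lexx.
move=> a Ea; have [a1 a2] := E0 Ea.
have := HM (Num.max 0 M + 1).
rewrite ltr_pwDr ?le_max ?lexx ?orbT// => /(_ isT _ Ea) aM.
have : Num.max `|a.1| `|a.2| <= Num.max 0 M + 1 := aM.
rewrite ge_max => /andP[h1 h2]; split => //.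
- by rewrite (le_trans (ler_norm _)).
- by rewrite (le_trans (ler_norm _)).
Qed.

(** For p = - ln x and q = - ln y this is the monomial weight with exponents - a.1 and - a.2; the
    exponential form makes monotonicity in [p] and [q] visible. *)
Definition expw (p q : R) (a : R * R) : R := expR (p * a.1 + q * a.2).

Lemma measurable_expw p q : measurable_fun E (expw p q).
Proof.
apply: measurable_funTS; apply: measurableT_comp => //.
by apply: measurable_funD; apply: measurable_funM.
Qed.

Lemma expw_bounded p q : exists M : R, forall a, E a -> expw p q a <= M.
Proof.
have [M M0 EM] := msupport_bounded.
exists (expR (`|p| * M + `|q| * M)) => a /EM[? ? ? ?].
rewrite ler_expR; apply: lerD.
  by rewrite (le_trans (ler_norm _))// normrM ler_wpM2l// ger0_norm.
by rewrite (le_trans (ler_norm _))// normrM ler_wpM2l// ger0_norm.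
Qed.

Lemma integrable_expw p q : mu.-integrable E (EFin \o expw p q).
Proof.
apply: measurable_bounded_integrable => //.
- by rewrite ltey_eq fin_num_measure.
- exact: measurable_expw.
have [M EM] := expw_bounded p q.
exists M; split; first exact: num_real.
move=> x Mx a Ea /=; rewrite gtr0_norm ?expR_gt0//.
by rewrite (le_trans (EM _ Ea))// ltW.
Qed.

Lemma le_expw p q p' q' a : E a -> p <= p' -> q <= q' ->
  expw p q a <= expw p' q' a.
Proof.
by move=> /E0[a1 a2] pp qq; rewrite ler_expR lerD// ler_wpM2r.
Qed.

Lemma TmuE S : Tmu mu S = expR (- 2 * S) * \int[mu]_(a in E) expw S S a.
Proof.
rewrite -RintegralZl//; last exact: integrable_expw.
apply: eq_Rintegral => a _; rewrite -expRD; congr expR; ring.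
Qed.

Lemma Tmu_ge0 S : 0 <= Tmu mu S.
Proof. by apply: Rintegral_ge0 => a _; exact: expR_ge0. Qed.

Lemma integrable_Tmu S : mu.-integrable E (fun a => (expR (- S * (2 - a.1 - a.2)))%:E).
Proof.
have := integrableZl mE (expR (- 2 * S)) (integrable_expw S S).
apply: eq_integrable => // a _; rewrite /= -EFinM -expRD; congr (expR _)%:E; ring.
Qed.

Lemma Tmu0_gt0 : 0 < Tmu mu 0.
Proof.
rewrite TmuE mulr0 expR0 mul1r /Rintegral fine_gt0//.
rewrite (eq_integral (cst 1%E)); last first.
  by move=> a _; rewrite /expw !mul0r addr0 expR0.
rewrite integral_cst// mul1e measure_msupport_gt0/=.
by rewrite ltey_eq fin_num_measure.
Qed.

(** Raising [S] to j + 1 can only increase the factor exp(S (a.1 + a.2)), the exponents being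
    nonnegative, and shrinks exp(- 2 S) by at most [expR 2]. No bound on [Amu mu] enters. *)
Lemma Tmu_le_succ S (j : nat) : j%:R <= S <= j.+1%:R ->
  Tmu mu S <= expR 2 * Tmu mu j.+1%:R.
Proof.
move=> /andP[jS Sj]; rewrite -RintegralZl//; last exact: integrable_Tmu.
apply: le_Rintegral => //.
- exact: integrable_Tmu.
- by have := integrableZl mE (expR 2) (integrable_Tmu j.+1%:R).
move=> a /E0[a1 a2]; rewrite -expRD ler_expR.
have : 0 <= (j.+1%:R - S) * (a.1 + a.2) by apply: mulr_ge0; [rewrite subr_ge0|exact: addr_ge0].
move: jS; rewrite -natr1; nra.
Qed.

Lemma le_sumexp_Amu a : E a -> a.1 + a.2 <= Amu mu.
Proof.
move=> Ea; apply: sup_upper_bound; last by exists a.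
split; first by exists (a.1 + a.2), a.
have [M _ EM] := msupport_bounded; exists (M + M) => _ [b /EM[? ? ? ?] <-].
exact: lerD.
Qed.

Lemma Tmu_nonincreasing S S' : Amu mu <= 2 -> S <= S' -> Tmu mu S' <= Tmu mu S.
Proof.
move=> A2 SS'; apply: le_Rintegral => //; [exact: integrable_Tmu..|].
move=> a /le_sumexp_Amu aA; rewrite ler_expR.
by have : 0 <= (S' - S) * (2 - a.1 - a.2); [rewrite mulr_ge0//; lra|nra].
Qed.

(** Some point of the support has coordinate sum above 2, so the open half-plane [W] has positive
    mass, and the integrand is at least 1 on it. *)
Lemma Tmu_bounded_below : 2 < Amu mu ->
  exists2 c : R, 0 < c & forall S, 0 <= S -> c <= Tmu mu S.
Proof.
move=> A2; have [a0 Ea0] : E !=set0.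
  apply/set0P/negP => /eqP E0'; have := measure_msupport_gt0.
  by rewrite E0' measure0 ltxx.
have [_ [a Ea <-] a2] : exists2 x, [set a.1 + a.2 | a in E] x & 2 < x.
  apply: sup_gt => //; by exists (a0.1 + a0.2), a0.
pose W : set (R * R) := [set a | 2 < a.1 + a.2].
have oW : open W.
  apply: (@open_comp _ _ (fun a : R * R => a.1 + a.2) [set x | 2 < x]); last exact: open_gt.
  move=> b _; apply: continuousD; [exact: cvg_fst|exact: cvg_snd].
have mW : measurable W := open_measurable_plane oW.
have muW : (0 < mu W)%E by exact: Ea oW a2.
have muEWfin : mu (E `&` W) \is a fin_num.
  by apply: fin_num_measure; exact: measurableI.
exists (fine (mu (E `&` W))).
  by rewrite fine_gt0// measureI_msupport// muW ltey_eq fin_num_measure.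
move=> S S0; rewrite /Tmu /Rintegral fine_le//.
  exact: integrable_fin_num (integrable_Tmu S).
rewrite -[mu (E `&` W)]mul1e -integral_cst//; last exact: measurableI.
apply: (@le_trans _ _ (\int[mu]_(a in E `&` W) (expR (- S * (2 - a.1 - a.2)))%:E)%E).
  apply: le_lower_integral => // b [_ Wb]; rewrite lee_fin -[leLHS]expR0 ler_expR.
  by have : 0 <= S * (b.1 + b.2 - 2); [rewrite mulr_ge0//; move: Wb; rewrite /W/=; lra|nra].
apply: lower_integral_subset => [b []//|b _]; by rewrite lee_fin expR_ge0.
Qed.

End weight_integrals.

(** * Open charts and sections of jointly measurable functions *)

Section charts.
Variables (R : realType) (k : nat).

Lemma open_open_chart (eps : R) (V : set 'rV[R]_k) : open V -> open (open_chart eps V).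
Proof.
move=> oV.
pose X := [set w : 'rV[R]_(2 + k) | 0 < xc w < eps].
pose Y := [set w : 'rV[R]_(2 + k) | 0 < yc w < eps].
have oitv (f : 'rV[R]_(2 + k) -> R) : continuous f -> open [set w | 0 < f w < eps].
  move=> cf; have -> : [set w | 0 < f w < eps] = f @^-1` `]0, eps[.
    by apply/seteqP; split => w; rewrite /= in_itv.
  by apply: open_comp => [w _|]; [exact: cf|exact: interval_open].
have -> : open_chart eps V = X `&` Y `&` (@rsubmx _ _ 2 k) @^-1` V.
  apply/seteqP; split => w; first by move=> [].
  by move=> [[]].
apply: openI; first by apply: openI; apply: oitv; exact: coord_continuous.
by apply: open_comp => // w _; exact: continuous_rsubmx.
Qed.

Lemma jointly_measurable_section (E : set (R * R)) (D : set 'rV[R]_k)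
    (u : R * R -> 'rV[R]_k -> R) w :
  measurable E -> open D -> jointly_measurable E D u -> D w ->
  measurable_fun E (u ^~ w).
Proof.
move=> mE oD mu Dw _ Y mY.
have mD : measurable (D : set (borel_rV R k)) by exact: sub_sigma_algebra.
have mED : measurable (E `*` D : set ((R * R) * borel_rV R k)%type) by exact: measurableX.
have := @measurable_ysection _ _ _ _ _ (w : borel_rV R k) (mu mED Y mY).
congr measurable; rewrite ysectionE; apply/seteqP; split => a /=.
  by move=> [[]].
by move=> [].
Qed.

End charts.

(** * Two-sided bounds for the conformal factor *)

Section weight_bounds.
Variables (R : realType) (mu : {finite_measure set (R * R)%type -> \bar R}).
Hypothesis cE : compact (msupport mu).
Hypothesis E0 : forall a, msupport mu a -> 0 <= a.1 /\ 0 <= a.2.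
Variables (k : nat) (u : R * R -> 'rV[R]_(2 + k) -> R) (cu Cu : R).
Variable w : 'rV[R]_(2 + k).
Hypothesis mu_w : measurable_fun (msupport mu) (u ^~ w).
Hypotheses (cu0 : 0 < cu) (Cu0 : 0 <= Cu).
Hypothesis ubound : {ae mu, forall a, msupport mu a -> cu <= u a w <= Cu}.
Hypothesis upos : forall a, msupport mu a -> 0 < u a w.
Hypotheses (x0 : 0 < xc w) (y0 : 0 < yc w).

Let E := msupport mu.
Let mE : measurable E. Proof. exact: measurable_msupport. Qed.
Let W a := (u a w * (xc w) `^ (- a.1) * (yc w) `^ (- a.2)).
Let P := expw (- ln (xc w)) (- ln (yc w)).

Let WE a : W a = u a w * P a.
Proof.
rewrite /W /P /expw /powR !gt_eqF// -mulrA -expRD; congr (_ * expR _); ring.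
Qed.

Let mW : measurable_fun E W.
Proof.
rewrite (_ : W = fun a => u a w * P a); last by apply/funext => a; rewrite WE.
by apply: measurable_funM => //; exact: measurable_expw.
Qed.

Let W0 a : E a -> 0 <= W a.
Proof. by move=> Ea; rewrite WE mulr_ge0 ?expR_ge0// ltW// upos. Qed.

Let expw_gt0 (p q : R) (a : R * R) : 0 < expw p q a.
Proof. exact: expR_gt0. Qed.

Let int_expwZ (c p q : R) : 0 <= c ->
  (\int[mu]_(a in E) (c * expw p q a)%:E = c%:E * \int[mu]_(a in E) (expw p q a)%:E)%E.
Proof.
move=> c0; under eq_integral do rewrite EFinM.
rewrite ge0_integralZl_EFin//.
- by move=> a _; rewrite lee_fin ltW.
- by apply/measurable_EFinP; exact: measurable_expw.
Qed.

Let measurable_expwZ (c p q : R) : measurable_fun E (fun a => (c * expw p q a)%:E).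
Proof. by apply/measurable_EFinP/measurable_funM => //; exact: measurable_expw. Qed.

Let W_le p q : - ln (xc w) <= p -> - ln (yc w) <= q ->
  (\int[mu]_(a in E) (W a)%:E <= Cu%:E * \int[mu]_(a in E) (expw p q a)%:E)%E.
Proof.
move=> xp yq; rewrite -int_expwZ//; apply: ae_ge0_le_integral => //.
- exact/measurable_EFinP.
- by move=> a _; rewrite lee_fin mulr_ge0// ltW.
apply: filterS ubound => a + Ea => /(_ Ea)/andP[_ uC].
rewrite lee_fin WE ler_pM//; first by rewrite ltW// upos.
  exact/ltW/expw_gt0.
exact: (le_expw E0).
Qed.

Let W_ge p q : p <= - ln (xc w) -> q <= - ln (yc w) ->
  (cu%:E * \int[mu]_(a in E) (expw p q a)%:E <= \int[mu]_(a in E) (W a)%:E)%E.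
Proof.
move=> xp yq; rewrite -int_expwZ//; last exact: ltW.
apply: ae_ge0_le_integral => //.
- by move=> a _; rewrite lee_fin mulr_ge0// ltW.
- exact/measurable_EFinP.
apply: filterS ubound => a + Ea => /(_ Ea)/andP[uC _].
rewrite lee_fin WE ler_pM//; [exact: ltW|exact/ltW/expw_gt0|exact: (le_expw E0)].
Qed.

Let fin_expw p q : (\int[mu]_(a in E) (expw p q a)%:E)%E \is a fin_num.
Proof. exact: integrable_fin_num (integrable_expw _ _ _ _). Qed.

(** [Fmu] is a real-valued integral, which would be the default value 0 if the extended integral
    were infinite. *)
Let fin_W : (\int[mu]_(a in E) (W a)%:E)%E \is a fin_num.
Proof.
rewrite ge0_fin_numE; last by apply: integral_ge0 => a Ea; rewrite lee_fin W0.
apply: le_lt_trans (W_le (lexx _) (lexx _)) _.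
by rewrite -[X in (_ * X)%E]fineK// -EFinM ltry.
Qed.

Let expw_TmuE S : (\int[mu]_(a in E) (expw S S a)%:E)%E = (expR (2 * S) * Tmu mu S)%:E.
Proof.
rewrite TmuE// mulrA -expRD (_ : _ + _ = 0) ?expR0 ?mul1r; last by ring.
by rewrite /Rintegral fineK//; exact: fin_expw.
Qed.

(** Here - ln x and - ln y are at most [S], so [expw S S] dominates the monomial weight, and its
    integral is [expR (2 * S) * Tmu mu S]. The lower bound below is symmetric. *)
Lemma Fmu_le S : expR (- S) <= xc w -> expR (- S) <= yc w ->
  Fmu mu u w <= Cu * (expR (2 * S) * Tmu mu S).
Proof.
move=> Sx Sy; rewrite -lee_fin EFinM -expw_TmuE /Fmu /Rintegral fineK//.
by apply: W_le; rewrite lerNl -ler_expR lnK.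
Qed.

Lemma Fmu_ge S : xc w <= expR (- S) -> yc w <= expR (- S) ->
  cu * (expR (2 * S) * Tmu mu S) <= Fmu mu u w.
Proof.
move=> Sx Sy; rewrite -lee_fin EFinM -expw_TmuE /Fmu /Rintegral fineK//.
by apply: W_ge; rewrite lerNr -ler_expR lnK.
Qed.

End weight_bounds.

(** * Comparing the integral of the square root of [Tmu] with the series of its integer values *)

Section integral_test.
Variables (R : realType) (mu : {finite_measure set (R * R)%type -> \bar R}).
Hypothesis cE : compact (msupport mu).
Hypothesis E0 : forall a, msupport mu a -> 0 <= a.1 /\ 0 <= a.2.
Hypothesis muT : mu setT != 0%E.
Variable S0 : R.
Hypothesis S00 : 0 <= S0.

Definition sqrtT (j : nat) : R := Num.sqrt (Tmu mu j%:R).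
Local Notation leb := (@lebesgue_measure R).

Lemma sqrtT_ge0 j : 0 <= sqrtT j.
Proof. exact: sqrtr_ge0. Qed.

Lemma sum_sqrtT_diverges_gt2 : 2 < Amu mu ->
  forall M K, exists2 N, (M <= N)%N & K < \sum_(M <= j < N) sqrtT j.
Proof.
move=> A2 M K; have [c c0 cT] := Tmu_bounded_below cE E0 muT A2.
have sc0 : 0 < Num.sqrt c by rewrite sqrtr_gt0.
pose n := (Num.truncn (K / Num.sqrt c)).+1.
exists (M + n)%N; first exact: leq_addr.
apply: (@lt_le_trans _ _ (\sum_(M <= j < M + n) Num.sqrt c)).
  rewrite sumr_const_nat addKn -mulr_natl -ltr_pdivrMr//.
  exact: truncnS_gt.
by apply: ler_sum => j _; rewrite ler_wsqrtr// cT.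
Qed.

(** By contraposition: on [j, j + 1] the integrand is at most e times [sqrtT j.+1], so bounded
    partial sums would make the integral finite. This comparison does not use monotonicity of
    [Tmu]. *)
Lemma sum_sqrtT_diverges_int : sqrt_Tmu_integral mu S0 = +oo%E ->
  forall M K, exists2 N, (M <= N)%N & K < \sum_(M <= j < N) sqrtT j.
Proof.
move=> Ioo M K; apply: contrapT => H.
(* The maximum with 0 covers the empty sums. *)
have {}H N : \sum_(M <= j < N) sqrtT j <= Num.max K 0.
  have [MN|/ltnW NM] := leqP M N; last by rewrite big_geq// le_max lexx orbT.
  rewrite le_max leNgt; apply/orP; left; apply/negP => KN.
  by apply: H; exists N.
suff : (sqrt_Tmu_integral mu S0 < +oo)%E by rewrite Ioo ltxx.
pose c (j : nat) := Num.sqrt (expR 2) * sqrtT j.+1.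
pose J (j : nat) : set R := `[j%:R, j.+1%:R]%classic.
apply: (@le_lt_trans _ _ (\sum_(0 <= j <oo) (c j * 1)%:E)%E).
  apply: (@lower_integral_le_step _ _ _ leb _ set0 _ J) => //.
  - by move=> j; exact: measurable_itv.
  - by move=> j; rewrite mulr_ge0 ?sqrtr_ge0.
  - move=> j; have JE : leb (J j) = 1%E.
      rewrite /J lebesgue_measure_itv/= lte_fin ltr_nat ltnSn.
      by rewrite -EFinB -natr1 addrC addKr.
    by rewrite le_eqVlt; apply/orP; left; apply/eqP.
  - rewrite setD0 => S /=; rewrite in_itv/= andbT => SS.
    have S_0 : 0 <= S := le_trans S00 SS.
    exists (Num.truncn S) => //=; rewrite /J/= in_itv/=.
    by have h := truncn_itv S_0; case/andP: h => h1 h2; rewrite h1 ltW.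
  - move=> j S _; rewrite /J/= in_itv/= => jS.
    by rewrite lee_fin /c /sqrtT -sqrtrM ?expR_ge0// ler_wsqrtr// Tmu_le_succ.
apply: (@le_lt_trans _ _ (Num.sqrt (expR 2) *
    (\sum_(0 <= j < M.+1) sqrtT j + Num.max K 0))%:E); last exact: ltry.
apply: lime_le.
  apply: is_cvg_nneseries => j _ _.
  by rewrite lee_fin mulr1 mulr_ge0 ?sqrtr_ge0.
near=> n; rewrite sumEFin lee_fin.
under eq_bigr do rewrite mulr1.
rewrite -mulr_sumr ler_wpM2l ?sqrtr_ge0//.
apply: (@le_trans _ _ (\sum_(0 <= j < n.+1) sqrtT j)).
  by rewrite big_nat_recl// lerDr sqrtT_ge0.
have [nM|Mn] := leqP n M.
  rewrite [X in _ <= X + _](@big_cat_nat _ _ _ n.+1)//= -addrA lerDl addr_ge0//.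
    by apply: sumr_ge0 => j _; exact: sqrtT_ge0.
  by rewrite le_max lexx orbT.
rewrite (@big_cat_nat _ _ _ M.+1)//=; last exact: leqW.
rewrite lerD2l; apply: le_trans (H n.+1).
rewrite [leRHS](@big_cat_nat _ _ _ M.+1)//=; last exact: leqW.
by rewrite lerDr sumr_ge0// => j _; exact: sqrtT_ge0.
Unshelve. all: by end_near. Qed.

(** For [Amu mu <= 2] the function [Tmu] is nonincreasing, so each term is at most the integral over
    the unit interval to its left; the series converges and its tails vanish. *)
Lemma sum_sqrtT_tail : Amu mu <= 2 -> (sqrt_Tmu_integral mu S0 < +oo)%E ->
  forall e : R, 0 < e -> exists N0, forall N, (N0 <= N)%N ->
    (\sum_(0 <= j <oo) (sqrtT (N + j))%:E <= e%:E)%E.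
Proof.
move=> A2 Ioo e e0; pose f (S : R) := (Num.sqrt (Tmu mu S))%:E.
pose M := (Num.truncn S0).+1.
have S0M : S0 <= M%:R by apply/ltW/truncnS_gt.
have f0 S : (0 <= f S)%E by rewrite lee_fin sqrtr_ge0.
have step n : (\sum_(0 <= j < n) (sqrtT (M.+1 + j))%:E <=
    \int[leb]_(S in `[M%:R, (M + n)%:R[) f S)%E.
  elim: n => [|n ih]; first by rewrite big_geq// integral_ge0.
  rewrite big_nat_recr//=.
  apply: le_trans (@lower_integral_superadd _ _ _ leb _ `[M%:R, (M + n)%:R[
    `[(M + n)%:R, (M + n).+1%:R[ f _ _ _ _) => //.
  - apply: leeD => //.
    apply: (@le_trans _ _ (\int[leb]_(S in `[(M + n)%:R, (M + n).+1%:R[)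
        (sqrtT (M.+1 + n))%:E)%E).
      have -> : (\int[leb]_(S in `[(M + n)%:R, (M + n).+1%:R[) (sqrtT (M.+1 + n))%:E =
          (sqrtT (M.+1 + n))%:E * leb `[(M + n)%:R, (M + n).+1%:R[%classic)%E.
        exact: (integral_cst leb (measurable_itv _)).
      rewrite lebesgue_measure_itv/= lte_fin ltr_nat ltnSn.
      by rewrite -EFinB -natr1 addrAC subrr add0r mule1.
    apply: le_lower_integral => S; first by rewrite lee_fin sqrtr_ge0.
    rewrite /= in_itv/= => /andP[_ /ltW Sn].
    rewrite lee_fin ler_wsqrtr//; apply: Tmu_nonincreasing => //.
  - by rewrite addnS; apply: subset_itvl; rewrite bnd_simp ler_nat.
  - by rewrite addnS; apply: subset_itvr; rewrite bnd_simp ler_nat leq_addr.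
  - apply/seteqP; split => // S /= []; rewrite !in_itv/= => /andP[_ h] /andP[h' _].
    by have := lt_le_trans h h'; rewrite ltxx.
have fin : (\sum_(0 <= j <oo) (sqrtT (M.+1 + j))%:E < +oo)%E.
  apply: le_lt_trans Ioo; apply: lime_le.
    by apply: is_cvg_nneseries => j _ _; rewrite lee_fin sqrtT_ge0.
  near=> n; apply: (le_trans (step n)).
  apply: lower_integral_subset => // S /=; rewrite !in_itv/= andbT => /andP[+ _].
  exact: le_trans.
have /(_ fin) tl := @nneseries_tail_cvg R (fun j => (sqrtT (M.+1 + j))%:E) xpredT.
have {}tl : (\sum_(N <= k <oo) (sqrtT (M.+1 + k))%:E @[N --> \oo] --> 0)%E.
  by apply: tl => k _; rewrite lee_fin sqrtT_ge0.
have /fine_cvgP[tfin /cvgrPdist_lt/(_ _ e0)[N1 _ HN1]] := tl.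
have [N2 _ HN2] := tfin.
exists (M.+1 + maxn N1 N2)%N => N NN.
(* The convergent series starts at [M.+1]; [N'] is the position of [N] in it. *)
pose N' := (N - M.+1)%N.
have NE : N = (M.+1 + N')%N by rewrite subnKC// (leq_trans _ NN)// leq_addr.
have : (maxn N1 N2 <= N')%N by rewrite -(leq_add2l M.+1) -NE.
rewrite geq_max => /andP[N1N N2N].
have := HN1 _ N1N; rewrite /= sub0r normrN => h.
apply: (@le_trans _ _ (\sum_(N' <= k <oo) (sqrtT (M.+1 + k))%:E)%E); last first.
  by rewrite -(fineK (HN2 _ N2N)) lee_fin ltW// (le_lt_trans (ler_norm _) h).
apply: lime_le.
  by apply: is_cvg_nneseries => j _ _; rewrite lee_fin sqrtT_ge0.
near=> n; apply: (@le_trans _ _ (\sum_(N' <= k < n + N') (sqrtT (M.+1 + k))%:E)%E).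
  rewrite -[X in index_iota X (n + N')]add0n big_addn addnK le_eqVlt; apply/orP; left.
  by apply/eqP; apply: eq_bigr => j _; rewrite NE -addnA (addnC j).
by apply: nneseries_lim_ge => k _ _; rewrite lee_fin sqrtT_ge0.
Unshelve. all: by end_near. Qed.

End integral_test.

(** * Lower bounds for curve lengths *)

Section last_passage.
Variable R : realType.
Implicit Types (a b x y : R) (f : R -> R).

(** [p] is the supremum of the times at which [f] is at least [y]. Continuity is required relative
    to [a, b] only, since a curve is uncontrolled outside its interval. *)
Lemma last_passage a b y f :
  (forall e : R, 0 < e -> exists2 d : R, 0 < d & forall s t : R,
    a <= s <= b -> a <= t <= b -> `|s - t| < d -> `|f s - f t| < e) ->
  a <= b -> f b <= y <= f a ->
  exists p, [/\ a <= p <= b, f p = y & forall t, p <= t <= b -> f t <= y].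
Proof.
move=> uf ab /andP[fby yfa].
pose A := [set t | a <= t <= b /\ y <= f t].
have Aa : A a by split=> //; rewrite lexx.
have supA : has_sup A by split; [exists a|exists b => t [/andP[]]].
pose p := sup A.
have ap : a <= p by apply: sup_upper_bound.
have pb : p <= b by apply: ge_sup; [exists a|move=> t [/andP[]]].
have apb : a <= p <= b by rewrite ap pb.
have yfp : y <= f p.
  rewrite leNgt; apply/negP => fpy.
  have e0 : 0 < y - f p by rewrite subr_gt0.
  have [d d0 H] := uf _ e0.
  have [t [tab yft] tp] := sup_adherent d0 supA.
  have tlep : t <= p by apply: sup_upper_bound.
  have := H p t apb tab; rewrite ger0_norm ?subr_ge0// ltrBlDr -ltrBlDl => /(_ tp).
  rewrite ltr_norml => /andP[h _]; lra.
have fplt t : p < t -> t <= b -> f t < y.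
  move=> pt tb; rewrite ltNge; apply/negP => yft.
  have : t <= p by apply: sup_upper_bound => //; split=> //; rewrite tb (le_trans ap (ltW pt)).
  by rewrite leNgt pt.
have fpy : f p <= y.
  (* If [f p] exceeded [y], then [p < b] and [f] would still exceed [y] shortly after [p], against
     the choice of [p]. *)
  rewrite leNgt; apply/negP => yp.
  have pltb : p < b.
    by rewrite lt_neqAle pb andbT; apply/eqP => E; move: yp fby; rewrite E; lra.
  have e0 : 0 < f p - y by rewrite subr_gt0.
  have [d d0 H] := uf _ e0.
  pose t := Num.min b (p + d / 2).
  have pt : p < t by rewrite lt_min pltb ltrDl divr_gt0.
  have tb : t <= b by rewrite ge_min lexx.
  have tpd : t <= p + d / 2 by rewrite ge_min lexx orbT.
  have := H p t apb; rewrite tb (le_trans ap (ltW pt)) => /(_ isT).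
  rewrite distrC ger0_norm ?subr_ge0 ?(ltW pt)// => h.
  have {}h : `|f p - f t| < f p - y by apply: h; lra.
  by have := fplt _ pt tb; move: h; rewrite ltr_norml => /andP[_ h]; lra.
exists p; split => //; first by apply/eqP; rewrite eq_le fpy.
move=> t /andP[]; rewrite le_eqVlt => /predU1P[<- //|pt tb].
exact/ltW/fplt.
Qed.

End last_passage.

Section lower_bounds.
Variables (R : realType) (k : nat).
Variables (g : 'rV[R]_(2 + k) -> 'M[R]_(2 + k)) (D : set 'rV[R]_(2 + k)).
Implicit Types (c : R -> 'rV[R]_(2 + k)) (w v : 'rV[R]_(2 + k)).

Lemma abs_continuousS n (c : R -> 'rV[R]_n) (a b x y : R) : a <= x -> y <= b ->
  abs_continuous a b c -> abs_continuous x y c.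
Proof.
move=> ax yb acc e /acc[d d0 H]; exists d => // m l r lr; apply: H => i.
have [? [? ?]] := lr i; split; first exact: le_trans ax _.
by split => //; exact: le_trans yb.
Qed.

Lemma curve_length_subset (I J : set R) c : I `<=` J ->
  (curve_length g I c <= curve_length g J c)%E.
Proof.
by move=> IJ; apply: lower_integral_subset => // t _; rewrite lee_fin sqrtr_ge0.
Qed.

Lemma intrinsic_dist_ge_coord (m : R) (p q : 'rV[R]_(2 + k)) i : 0 <= m ->
  (forall w v, D w -> m * enorm v <= Num.sqrt (quad (g w) v)) ->
  ((m * `|q 0 i - p 0 i|)%:E <= intrinsic_dist g D p q)%E.
Proof.
move=> m0 mg; apply: le_ereal_inf_tmp => _ [c [acc cD <- <- ->]].
apply: (@le_trans _ _ (curve_length g `]0, 1]%classic c)); last first.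
  by apply: curve_length_subset; apply: subset_itvr; rewrite bnd_simp.
have sumE v : \sum_j (j == i)%:R * v 0 j = v 0 i.
  rewrite (bigD1 i)//= eqxx mul1r big1 ?addr0// => j /negbTE->.
  by rewrite mul0r.
have := @curve_length_ge R (2 + k) g c 0 1 (fun j => (j == i)%:R) m ler01 m0 acc.
have -> : \sum_j (j == i)%:R * (c 1 0 j - c 0 0 j) = c 1 0 i - c 0 0 i.
  by have := sumE (c 1 - c 0); rewrite !mxE => <-; apply: eq_bigr => j _; rewrite !mxE.
apply => t v t01; rewrite sumE; apply: le_trans (mg _ _ (cD _ t01)).
by rewrite ler_wpM2l// coord_le_enorm.
Qed.

(** Being linear, it integrates its derivative along curves; on the chart it dominates both
    coordinates, so a bound on it puts a point where the lower metric bound holds. *)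
Definition radial (w : 'rV[R]_(2 + k)) : R := xc w + yc w.

Let rcoef (i : 'I_(2 + k)) : R := if fintype.split i is inl _ then 1 else 0.

Let radialE v : \sum_i rcoef i * v 0 i = radial v.
Proof.
have spl (i : 'I_2) : fintype.split (lshift k i) = inl i := unsplitK (inl i).
have spr (i : 'I_k) : fintype.split (rshift 2 i) = inr i := unsplitK (inr i).
rewrite /rcoef big_split_ord/= [X in _ + X]big1 ?addr0; last first.
  by move=> i _; rewrite spr mul0r.
rewrite !big_ord_recl big_ord0 addr0 !spl !mul1r /radial /xc /yc.
by congr (_ + v 0 (lshift k _)); exact: val_inj.
Qed.

Let radial_le v : `|radial v| <= 2 * enorm v.
Proof.
rewrite (le_trans (ler_normD _ _))// mulr_natl mulr2n.
by apply: lerD; exact: coord_le_enorm.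
Qed.

Lemma radial_unif a b c : abs_continuous a b c ->
  forall e : R, 0 < e -> exists2 d : R, 0 < d & forall s t : R,
    a <= s <= b -> a <= t <= b -> `|s - t| < d ->
    `|radial (c s) - radial (c t)| < e.
Proof.
move=> acc e e0; have e20 : 0 < e / 2 by rewrite divr_gt0.
have [d1 d10 H1] := real_abs_continuous_within
  (abs_continuous_coord (lshift k 0) acc) e20.
have [d2 d20 H2] := real_abs_continuous_within
  (abs_continuous_coord (lshift k 1) acc) e20.
exists (Num.min d1 d2); first by rewrite lt_min d10.
move=> s t sab tab; rewrite lt_min => /andP[/H1-/(_ sab tab) h1 /H2-/(_ sab tab) h2].
rewrite (splitr e); apply: le_lt_trans (ltrD h1 h2).
rewrite /radial /xc /yc opprD addrACA; exact: ler_normD.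
Qed.

Lemma continuous_radial : continuous radial.
Proof.
move=> w.
have cx : continuous (fun w : 'rV[R]_(2 + k) => xc w) by exact: coord_continuous.
have cy : continuous (fun w : 'rV[R]_(2 + k) => yc w) by exact: coord_continuous.
exact: cvgD (cx w) (cy w).
Qed.

Lemma radial_corner z : radial (corner_point z) = 0 :> R.
Proof. by rewrite /radial /xc /yc /corner_point !row_mxEl !mxE addr0. Qed.

Variable theta : nat -> R.
Hypothesis theta0 : forall j, 0 <= theta j.
Hypothesis D0 : forall w, D w -> 0 < xc w /\ 0 < yc w.
Hypothesis g_ge : forall j w v, D w ->
  xc w <= expR (- j%:R) -> yc w <= expR (- j%:R) ->
  expR j%:R * theta j * enorm v <= Num.sqrt (quad (g w) v).

(** Descending from level e^-j to e^-(j+1) costs e^j [theta j] times the drop, that is (1 - 1/e)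
    [theta j]; the half comes from [radial_le]. *)
Let kappa : R := (1 - expR (-1)) / 2.

(** One level per induction step. From the last passage [p] at level e^-M on, both coordinates stay
    below e^-M, so the metric bound of index [M] holds up to the last passage [q] at the next level;
    the rest of the curve is left to induction. *)
Lemma curve_length_ge_sum a b c M n : a <= b -> abs_continuous a b c ->
  (forall t, a <= t <= b -> D (c t)) ->
  expR (- M%:R) <= radial (c a) -> radial (c b) <= expR (- (M + n)%:R) ->
  ((kappa * \sum_(M <= j < M + n) theta j)%:E <= curve_length g `]a, b]%classic c)%E.
Proof.
elim: n M a => [|n ih] M a ab acc cD Ma bM.
  by rewrite addn0 big_geq// mulr0; exact: curve_length_ge0.
have leM : expR (- (M + n.+1)%:R) <= expR (- M%:R) :> R.
  by rewrite ler_expR lerN2 ler_nat leq_addr.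
have leM1 : expR (- (M + n.+1)%:R) <= expR (- M.+1%:R) :> R.
  by rewrite ler_expR lerN2 ler_nat addnS ltnS leq_addr.
have [|p [/andP[ap pb] rp rpb]] := @last_passage R a b (expR (- M%:R))
  (radial \o c) (radial_unif acc) ab.
  by rewrite /= Ma (le_trans bM).
have accp : abs_continuous p b c by exact: abs_continuousS acc.
have [|q [/andP[pq qb] rq _]] := @last_passage R p b (expR (- M.+1%:R))
  (radial \o c) (radial_unif accp) pb.
  by rewrite rp /= (le_trans bM)//= ler_expR lerN2 ler_nat.
have accq : abs_continuous q b c by exact: abs_continuousS accp.
have accpq : abs_continuous p q c by exact: abs_continuousS accp.
have cDq t : q <= t <= b -> D (c t).
  by move=> /andP[qt tb]; apply: cD; rewrite tb andbT (le_trans ap)// (le_trans pq).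
have := ih M.+1 q qb accq cDq; rewrite -[X in X <= _ -> _]rq lexx => /(_ isT).
rewrite addSnnS => /(_ bM) ihq.
rewrite big_ltn; last by rewrite addnS ltnS leq_addr.
rewrite mulrDr EFinD.
apply: le_trans (@lower_integral_superadd _ _ _ (@lebesgue_measure R) _
  `]p, q] `]q, b] _ _ _ _ _).
- apply: leeD; last exact: ihq.
  have := @curve_length_ge R (2 + k) g c p q
    rcoef (expR M%:R * theta M / 2) pq _ accpq.
  rewrite divr_ge0 ?mulr_ge0 ?expR_ge0// => /(_ isT).
  have -> : \sum_i rcoef i * (c q 0 i - c p 0 i) =
      expR (- M.+1%:R) - expR (- M%:R).
    transitivity (radial (c q - c p)).
      by rewrite -radialE; apply: eq_bigr => i _; rewrite !mxE.
    rewrite -rq -rp /= /radial /xc /yc !mxE; ring.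
  have -> : expR M%:R * theta M / 2 * `|expR (- M.+1%:R) - expR (- M%:R)| = kappa * theta M.
    rewrite distrC ger0_norm ?subr_ge0 ?ler_expR ?lerN2 ?ler_nat//.
    rewrite -[M.+1]addn1 natrD opprD expRD /kappa.
    have : expR M%:R * expR (- M%:R) = 1 :> R by rewrite -expRD subrr expR0.
    move: (expR M%:R) (expR (- M%:R)) => x y xy.
    have -> : x * theta M / 2 * (y - y * expR (- 1%:R)) =
      (x * y) * (theta M / 2 * (1 - expR (- 1%:R))) by ring.
    by rewrite xy mul1r; ring.
  apply => t v /andP[pt tq].
  have tb := le_trans tq qb.
  have Dct : D (c t) by apply: cD; rewrite tb (le_trans ap pt).
  have [xt0 yt0] := D0 Dct.
  have rt : radial (c t) <= expR (- M%:R) by apply: rpb; rewrite pt tb.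
  have xt : xc (c t) <= expR (- M%:R) by apply: le_trans rt; rewrite lerDl ltW.
  have yt : yc (c t) <= expR (- M%:R) by apply: le_trans rt; rewrite lerDr ltW.
  rewrite radialE; apply: le_trans (g_ge v Dct xt yt).
  rewrite -mulrA ler_wpM2l ?mulr_ge0 ?expR_ge0//.
  by rewrite ler_pdivrMl.
- by move=> t /=; rewrite !in_itv/= => /andP[pt /le_trans->//]; rewrite (le_lt_trans ap pt).
- move=> t /=; rewrite !in_itv/= => /andP[qt ->]; rewrite andbT.
  by rewrite (le_lt_trans _ qt)// (le_trans ap).
- apply/seteqP; split => // t /= []; rewrite !in_itv/= => /andP[_ h] /andP[h' _].
  by have := lt_le_trans h' h; rewrite ltxx.
- by move=> t _; rewrite lee_fin sqrtr_ge0.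
Qed.

Hypothesis theta_div : forall M K, exists2 N, (M <= N)%N &
  K < \sum_(M <= j < N) theta j.

Let kappa_gt0 : 0 < kappa.
Proof. by rewrite divr_gt0// subr_gt0 -[X in _ < X]expR0 ltr_expR. Qed.

(** The starting point fixes the first level [M], divergence the last level [N]; the radius e^-N
    depends on no curve, which yields both infinite length and unbounded distance. *)
Lemma curve_length_unbounded w : D w -> forall K : R, exists2 r : R, 0 < r &
  forall a b c, a <= b -> abs_continuous a b c ->
    (forall t, a <= t <= b -> D (c t)) -> c a = w -> radial (c b) <= r ->
    (K%:E < curve_length g `]a, b]%classic c)%E.
Proof.
move=> Dw K; have [x0 y0] := D0 Dw.
have r0 : 0 < radial w by rewrite addr_gt0.
pose M := (Num.truncn (- ln (radial w))).+1.
have Mw : expR (- M%:R) <= radial w.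
  by rewrite -[leRHS]lnK// ler_expR lerNl ltW// truncnS_gt.
have [N MN KN] := theta_div M (K / kappa).
exists (expR (- N%:R)); first exact: expR_gt0.
move=> a b c ab acc cD ca cb.
apply: (@lt_le_trans _ _ (kappa * \sum_(M <= j < N) theta j)%:E).
  by rewrite lte_fin mulrC -ltr_pdivrMr.
have := @curve_length_ge_sum a b c M (N - M) ab acc cD.
by rewrite subnKC// ca; apply.
Qed.

Lemma infinite_intrinsic_distance_corner z :
  infinite_intrinsic_distance g D (corner_point z).
Proof.
move=> c acc cD cp; apply/eqyP => K _.
have D0' : D (c 0) by apply: cD; rewrite lexx ltr01.
have [r r0 H] := curve_length_unbounded D0' K.
have rp : radial (c t) @[t --> 1^'-] --> radial (corner_point z).
  exact: (cvg_comp _ _ cp (@continuous_radial _)).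
have [t [[t0 t1] ct]] : exists t : R, (0 < t /\ t < 1) /\ radial (c t) < r.
  apply: (@filter_ex _ (1 : R)^'-); near=> t; split; first split.
  - by near: t; exact: nbhs_left_gt.
  - by near: t; exact: nbhs_left_lt.
  - by near: t; apply: (cvgr_lt _ rp); rewrite radial_corner.
have acct : abs_continuous 0 t c by apply: acc; rewrite t0.
apply: (@le_trans _ _ (curve_length g `]0, t]%classic c)).
  apply/ltW/H => //; [exact: ltW|move=> s /andP[s0 st]|exact: ltW].
  by apply: cD; rewrite s0 (le_lt_trans st).
apply: curve_length_subset => s /=; rewrite !in_itv/= => /andP[/ltW -> st].
exact: le_lt_trans t1.
Unshelve. all: by end_near. Qed.

Lemma intrinsic_dist_unbounded w : D w -> forall K : R, exists2 r : R, 0 < r &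
  forall w', radial w' <= r -> (K%:E <= intrinsic_dist g D w w')%E.
Proof.
move=> Dw K; have [r r0 H] := curve_length_unbounded Dw K.
exists r => // w' w'r; apply: le_ereal_inf_tmp => _ [c [acc cD c0 c1 ->]].
apply: (@le_trans _ _ (curve_length g `]0, 1]%classic c)).
  by apply/ltW/H => //; rewrite c1.
by apply: curve_length_subset; apply: subset_itvr; rewrite bnd_simp.
Qed.

End lower_bounds.

(** * Short arcs near the corner *)

Lemma lipschitz_abs_continuous (R : realType) (n : nat) (c : R -> 'rV[R]_n) (a b L : R) :
  0 <= L -> (forall s t, a <= s -> s <= t -> t <= b -> enorm (c t - c s) <= L * (t - s)) ->
  abs_continuous a b c.
Proof.
move=> L0 cL e e0; exists (e / (L + 1)); first by rewrite divr_gt0// ltr_wpDl.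
move=> m l r lr _; rewrite ltr_pdivlMr ?ltr_wpDl// => lt_e.
have s0 : 0 <= \sum_(i < m) (r i - l i).
  by apply: sumr_ge0 => i _; rewrite subr_ge0; have [_ []] := lr i.
apply: (@le_lt_trans _ _ (L * \sum_(i < m) (r i - l i))); last by lra.
rewrite mulr_sumr; apply: ler_sum => i _; have [? [? ?]] := lr i; exact: cL.
Qed.

Section convexity.
Variables (R : realType) (k : nat).

Lemma eball_convex (z r : _) (x y : 'rV[R]_k) (t : R) : 0 <= t <= 1 ->
  eball z r x -> eball z r y -> eball z r (x + t *: (y - x)).
Proof.
rewrite /eball/= => /andP[t0 t1] xr yr.
have r0 : 0 < r by exact: le_lt_trans (enorm_ge0 _) xr.
have lt_sqr (v : 'rV[R]_k) : (enorm v < r) = (enorm v ^+ 2 < r ^+ 2).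
  by rewrite ltr_sqr// nnegrE ?enorm_ge0// ltW.
move: xr yr; rewrite !lt_sqr !sqr_enorm => xr yr.
set X := \sum_(i < k) _ in xr; set Y := \sum_(i < k) _ in yr.
apply: (@le_lt_trans _ _ ((1 - t) * X + t * Y)).
  rewrite !mulr_sumr -big_split/=; apply: ler_sum => i _; rewrite !mxE.
  set a := x 0 i; set b := y 0 i; set d := z 0 i.
  (* This is exactly the convexity gap of the square, in each coordinate. *)
  have : 0 <= t * (1 - t) * (a - b) ^+ 2.
    by apply: mulr_ge0; [apply: mulr_ge0; lra|exact: sqr_ge0].
  nra.
(* For positive [t] strictness comes from the second endpoint; at [t = 0] it must come from the
   first. *)
have [->|tn0] := eqVneq t 0; first by rewrite subr0 mul1r mul0r addr0.
have tp : 0 < t by rewrite lt_neqAle eq_sym tn0.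
have : t * Y < t * r ^+ 2 by rewrite ltr_pM2l.
have : (1 - t) * X <= (1 - t) * r ^+ 2 by rewrite ler_wpM2l ?subr_ge0// ltW.
lra.
Qed.

End convexity.

Section upper_bound.
Variables (R : realType) (k : nat) (eps rB : R) (zB : 'rV[R]_k).
Variable g : 'rV[R]_(2 + k) -> 'M[R]_(2 + k).
Implicit Types (w v : 'rV[R]_(2 + k)).
Let D := open_chart eps (eball zB rB).
Variable theta : nat -> R.
Hypothesis theta0 : forall j, 0 <= theta j.
Hypothesis g_le : forall j w v, D w ->
  expR (- j%:R) <= xc w -> expR (- j%:R) <= yc w ->
  Num.sqrt (quad (g w) v) <= expR j%:R * theta j * enorm v.

Let dir : 'rV[R]_(2 + k) := row_mx (const_mx 1) 0.

(** The chord pushed off both faces by a parabola in the direction (1, 1, 0); the [z] part remains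
    the segment, hence stays in the ball. *)
Definition arc (rho : R) w w' (t : R) : 'rV[R]_(2 + k) :=
  w + t *: (w' - w) + (rho * (t * (1 - t))) *: dir.

Let dir01 i : 0 <= dir 0 i <= 1.
Proof.
by rewrite /dir mxE; case: fintype.splitP => j _; rewrite mxE ?ler01 ?lexx.
Qed.

Let arcE rho w w' t i :
  arc rho w w' t 0 i = w 0 i + t * (w' 0 i - w 0 i) + rho * (t * (1 - t)) * dir 0 i.
Proof. by rewrite /arc; move: (dir) => e; rewrite !mxE. Qed.

Let dir_l i : dir 0 (lshift k i) = 1.
Proof. by rewrite /dir row_mxEl mxE. Qed.

Let dir_r i : dir 0 (rshift 2 i) = 0.
Proof. by rewrite /dir row_mxEr mxE. Qed.

Let xc_arc rho w w' t : xc (arc rho w w' t) = xc w + t * (xc w' - xc w) + rho * (t * (1 - t)).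
Proof. by rewrite /xc arcE dir_l mulr1. Qed.

Let yc_arc rho w w' t : yc (arc rho w w' t) = yc w + t * (yc w' - yc w) + rho * (t * (1 - t)).
Proof. by rewrite /yc arcE dir_l mulr1. Qed.

Let zc_arc rho w w' t : zc (arc rho w w' t) = zc w + t *: (zc w' - zc w).
Proof.
apply/rowP => i; rewrite /zc mxE arcE dir_r mulr0 addr0.
by rewrite !mxE.
Qed.

Lemma derive1_arc rho w w' t i :
  derive1 (arc rho w w') t 0 i = w' 0 i - w 0 i + rho * (1 - 2 * t) * dir 0 i.
Proof.
have df j (s : R) : is_derive s 1 (fun s => arc rho w w' s 0 j)
    (w' 0 j - w 0 j + rho * (1 - 2 * s) * dir 0 j).
  rewrite (_ : (fun s => arc rho w w' s 0 j) =
    (fun s => w 0 j + s * (w' 0 j - w 0 j) + rho * (s * (1 - s)) * dir 0 j)); last first.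
    by apply/funext => x; rewrite arcE.
  apply: is_derive_eq; rewrite /GRing.scale/=; ring.
have dc : derivable (arc rho w w') t 1.
  by apply/derivable_mxP => i' j; rewrite (ord1 i'); have [] := df j t.
rewrite derive1E derive_mx// mxE; exact: derive_val.
Qed.

Section close_points.
Variables (rho : R) (w w' : 'rV[R]_(2 + k)).
Hypotheses (rho0 : 0 < rho) (Dw : D w) (Dw' : D w').
Hypothesis ww' : forall i, `|w' 0 i - w 0 i| <= rho.
Hypothesis w_eps : [/\ xc w + rho < eps, yc w + rho < eps,
  xc w' + rho < eps & yc w' + rho < eps].

Let parabola (t : R) : 0 <= t <= 1 -> 0 <= t * (1 - t) <= 1.
Proof. by move=> /andP[t0 t1]; apply/andP; split; nra. Qed.

Lemma arc_in_chart t : 0 <= t <= 1 -> D (arc rho w w' t).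
Proof.
move=> t01; have [x0 y0 z0] := Dw; have [x0' y0' z0'] := Dw'.
have [e1 e2 e3 e4] := w_eps; have /andP[p0 p1] := parabola t01.
have rp : rho * (t * (1 - t)) <= rho by rewrite ger_pMr.
have rp0 : 0 <= rho * (t * (1 - t)) by rewrite mulr_ge0// ltW.
have coord (x x' : R) : 0 < x -> 0 < x' -> x + rho < eps -> x' + rho < eps ->
    0 < x + t * (x' - x) + rho * (t * (1 - t)) < eps.
  move=> xp xp' xe xe'; case/andP: t01 => t0 t1.
  have [tl|tr] := leP t (1 / 2); apply/andP; split; nra.
split; last by rewrite zc_arc; apply: eball_convex.
  by rewrite xc_arc; apply: coord => //; [case/andP: x0|case/andP: x0'].
by rewrite yc_arc; apply: coord => //; [case/andP: y0|case/andP: y0'].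
Qed.

Lemma arc_abs_continuous : abs_continuous 0 1 (arc rho w w').
Proof.
apply: (@lipschitz_abs_continuous _ _ _ _ _ (Num.sqrt (2 + k)%:R * (2 * rho))).
  by rewrite mulr_ge0 ?sqrtr_ge0// mulr_ge0// ltW.
move=> s t s0 st t1; rewrite -mulrA; apply: enorm_le.
  by rewrite mulr_ge0 ?subr_ge0// mulr_ge0// ltW.
move=> i; have -> : (arc rho w w' t - arc rho w w' s) 0 i =
    (t - s) * ((w' 0 i - w 0 i) + rho * dir 0 i * (1 - t - s)).
  by rewrite mxE [X in _ + X]mxE !arcE; ring.
have ts : 0 <= t - s by rewrite subr_ge0.
rewrite normrM mulrC (ger0_norm ts) ler_wpM2r//.
rewrite (le_trans (ler_normD _ _))// mulr_natl mulr2n lerD//.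
have /andP[d0 d1] := dir01 i.
rewrite -mulrA normrM (gtr0_norm rho0) ger_pMr// normrM (ger0_norm d0).
rewrite -[leRHS]mulr1 ler_pM// ler_norml; apply/andP; split; lra.
Qed.

Lemma enorm_derive1_arc t : 0 <= t <= 1 ->
  enorm (derive1 (arc rho w w') t) <= Num.sqrt (2 + k)%:R * (2 * rho).
Proof.
move=> /andP[t0 t1]; apply: enorm_le; first by rewrite mulr_ge0// ltW.
move=> i; rewrite derive1_arc (le_trans (ler_normD _ _))// [leRHS]mulr_natl mulr2n lerD//.
have /andP[d0 d1] := dir01 i.
rewrite -mulrA normrM (gtr0_norm rho0) ger_pMr// normrM (ger0_norm d0).
rewrite -[leRHS]mulr1 ler_pM// ler_norml; apply/andP; split; lra.
Qed.

End close_points.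

(** The times whose distance to the nearer end of [0, 1] lies between e^-(j+1) and e^-j. *)
Let shell (j : nat) : set R :=
  (`[expR (- j.+1%:R), expR (- j%:R)] `&` `[0, 1 / 2]) `|`
  (`[1 - expR (- j%:R), 1 - expR (- j.+1%:R)] `&` `[1 / 2, 1]).

Let measurable_shell j : measurable (shell j).
Proof. by apply: measurableU; apply: measurableI; exact: measurable_itv. Qed.

Let measure_shell j : (@lebesgue_measure R (shell j) <= (2 * expR (- j%:R))%:E)%E.
Proof.
have e1 : expR (- j.+1%:R) <= expR (- j%:R) :> R by rewrite ler_expR lerN2 ler_nat.
have e0 : 0 < expR (- j.+1%:R) :> R by exact: expR_gt0.
have itvle (a b c d : R) : a <= b -> b - a <= expR (- j%:R) ->
    (@lebesgue_measure R (`[a, b] `&` `[c, d]) <= (expR (- j%:R))%:E)%E.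
  move=> ab abj; apply: (@le_trans _ _ (@lebesgue_measure R `[a, b]%classic)).
    apply: le_measure; rewrite ?inE; last exact: subIsetl.
      by apply: measurableI; exact: measurable_itv.
    exact: measurable_itv.
  rewrite lebesgue_measure_itv/=; case: ifPn => _; last by rewrite lee_fin expR_ge0.
  by rewrite -EFinB lee_fin.
rewrite mulr_natl mulr2n EFinD.
apply: (le_trans (measureU2 _ _ _)).
- by apply: measurableI; exact: measurable_itv.
- by apply: measurableI; exact: measurable_itv.
by apply: leeD; apply: itvle; lra.
Qed.

Let expRN1_half : expR (- 1) <= 1 / 2 :> R.
Proof.
have := expR_ge1Dx (1 : R); have : expR 1 * expR (- 1) = 1 :> R by rewrite -expRD subrr expR0.
have := expR_gt0 (- 1 : R); nra.
Qed.

(** The nearer end is at least e^-(j+1) away and the other at least 1/2, which is at least 1/e. *)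
Let shell_parabola j t : shell j t -> expR (- j.+2%:R) <= t * (1 - t).
Proof.
have -> : expR (- j.+2%:R) = expR (- j.+1%:R) * expR (- 1) :> R.
  by rewrite -expRD -[j.+2]addn1 natrD opprD.
have h0 := expR_gt0 (- j.+1%:R : R); have := expRN1_half; have := expR_gt0 (- 1 : R).
move: (expR (- 1)) => a a0 a2.
case=> -[]; rewrite /= !in_itv/= => /andP[h1 h2] /andP[h3 h4].
  have : 0 <= (t - expR (- j.+1%:R)) * (1 - t) by rewrite mulr_ge0; lra.
  have : expR (- j.+1%:R) * a <= expR (- j.+1%:R) * (1 - t) by rewrite ler_wpM2l//; lra.
  lra.
have : 0 <= (1 - t - expR (- j.+1%:R)) * t by rewrite mulr_ge0; lra.
have : expR (- j.+1%:R) * a <= expR (- j.+1%:R) * t by rewrite ler_wpM2l//; lra.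
lra.
Qed.

Let shell_cover t : 0 < t < 1 -> exists j, shell j t.
Proof.
move=> /andP[t0 t1].
have log (s : R) : 0 < s -> s <= 1 / 2 -> exists j : nat,
    expR (- j.+1%:R) <= s <= expR (- j%:R).
  move=> s0 s2; have ls : 0 <= - ln s by rewrite oppr_ge0 ln_le0//; lra.
  exists (Num.truncn (- ln s)); have := truncn_itv ls => /andP[h1 h2].
  rewrite -[s in _ <= s <= _]lnK// !ler_expR; apply/andP; split; lra.
have [th|th] := leP t (1 / 2).
  have [j /andP[h1 h2]] := log t t0 th.
  by exists j; left; split; rewrite /= in_itv/= ?h1 ?h2 ?th ?andbT//; lra.
have [||j /andP[h1 h2]] := log (1 - t); [lra|lra|].
by exists j; right; split; rewrite /= in_itv/=; apply/andP; split; lra.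
Qed.

(** The speed bound 2 sqrt(2 + k) [rho], the shell measure 2 e^-j and the metric factor e^(N+2+j)
    multiply to this constant, because [rho] is e^-N. *)
Let K : R := Num.sqrt (2 + k)%:R * 4 * expR 2.

Lemma intrinsic_dist_le (N : nat) w w' : D w -> D w' ->
  (forall i, `|w' 0 i - w 0 i| <= expR (- N%:R)) ->
  [/\ xc w + expR (- N%:R) < eps, yc w + expR (- N%:R) < eps,
    xc w' + expR (- N%:R) < eps & yc w' + expR (- N%:R) < eps] ->
  (intrinsic_dist g D w w' <= \sum_(0 <= j <oo) (K * theta (N.+2 + j))%:E)%E.
Proof.
move=> Dw Dw' ww' w_eps; set rho := expR (- N%:R) in ww' w_eps *.
have rho0 : 0 < rho by exact: expR_gt0.
have arcD := arc_in_chart rho0 Dw Dw' w_eps.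
have acD := arc_abs_continuous rho0 ww'.
pose s := Num.sqrt (2 + k)%:R * (2 * rho).
have s0 : 0 <= s by rewrite mulr_ge0 ?sqrtr_ge0// mulr_ge0// ltW.
pose c (j : nat) := expR (N.+2 + j)%:R * theta (N.+2 + j) * s.
apply: (@le_trans _ _ (curve_length g `[0, 1]%classic (arc rho w w'))).
  apply: ereal_inf_lbound; exists (arc rho w w'); split => //.
    by rewrite /arc scale0r mul0r mulr0 scale0r !addr0.
  by rewrite /arc scale1r subrr mulr0 mulr0 scale0r addr0 addrC subrK.
apply: (@le_trans _ _ (\sum_(0 <= j <oo) (c j * (2 * expR (- j%:R)))%:E)%E).
  (* The shells miss exactly the endpoints 0 and 1, which form the null set. *)
  apply: (@lower_integral_le_step _ _ _ (@lebesgue_measure R)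
    `[0, 1]%classic [set 0; 1] _ shell).
  - exact: measurable_itv.
  - by apply: measurableU; exact: measurable_set1.
  - apply: (etrans (measureU0 _ _ _)); try exact: measurable_set1.
      exact: lebesgue_measure_set1.
    exact: lebesgue_measure_set1.
  - exact: measurable_shell.
  - by move=> j; rewrite /c mulr_ge0// mulr_ge0// expR_ge0.
  - exact: measure_shell.
  - move=> t [/=]; rewrite in_itv/= => /andP[t0 t1] /not_orP[tn0 tn1].
    have [|j jt] := @shell_cover t; last by exists j.
    by rewrite !lt_neqAle t0 t1 !andbT; apply/andP; split; apply/eqP => // E; apply: tn0.
  - by move=> t _; rewrite lee_fin sqrtr_ge0.
  move=> j t; rewrite /= in_itv/= => t01 jt.
  have Dt := arcD t t01; rewrite lee_fin.
  have pt := shell_parabola jt.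
  have lowp : expR (- (N.+2 + j)%:R) <= rho * (t * (1 - t)).
    apply: le_trans (_ : rho * expR (- j.+2%:R) <= _); last by rewrite ler_wpM2l// ltW.
    rewrite /rho -expRD ler_expR -opprD -natrD lerN2 ler_nat.
    by rewrite addSnnS addSnnS.
  have low (x x' : R) : 0 < x -> 0 < x' ->
      expR (- (N.+2 + j)%:R) <= x + t * (x' - x) + rho * (t * (1 - t)).
    move=> x0 x0'; case/andP: t01 => t0 t1.
    have : 0 <= x + t * (x' - x) by nra.
    by move: lowp; lra.
  have [/andP[x0 _] /andP[y0 _] _] := Dw; have [/andP[x0' _] /andP[y0' _] _] := Dw'.
  have := g_le (derive1 (arc rho w w') t) Dt.
  rewrite xc_arc yc_arc => /(_ _ (low _ _ x0 x0') (low _ _ y0 y0')) h.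
  apply: (le_trans h); rewrite /c ler_wpM2l ?mulr_ge0 ?expR_ge0//.
  exact: enorm_derive1_arc.
apply: lee_nneseries => j *.
  by rewrite lee_fin mulr_ge0 ?mulr_ge0 ?expR_ge0.
rewrite lee_fin le_eqVlt; apply/orP; left; apply/eqP.
have -> : c j = expR N%:R * expR 2 * expR j%:R * theta (N.+2 + j) * s.
  by rewrite /c -!expRD -!natrD addn2.
rewrite /s /K /rho.
have e1 : expR N%:R * expR (- N%:R) = 1 :> R by rewrite -expRD subrr expR0.
have e2 : expR j%:R * expR (- j%:R) = 1 :> R by rewrite -expRD subrr expR0.
set q := Num.sqrt _; set th := theta _.
transitivity ((expR N%:R * expR (- N%:R)) * (expR j%:R * expR (- j%:R)) *
  (q * 4 * expR 2 * th)); first by ring.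
by rewrite e1 e2 !mul1r.
Qed.

End upper_bound.

(** * The completion fibre *)

Section row_sequences.
Variables (R : realType) (n : nat).
Implicit Types (s t : nat -> 'rV[R]_n) (p : 'rV[R]_n).

Lemma cvg_coordP s p : s @ \oo --> p <->
  forall e : R, 0 < e -> exists N, forall m, (N <= m)%N ->
    forall i, `|s m 0 i - p 0 i| <= e.
Proof.
split=> [/cvgrPdist_le sp e e0|H].
  have [N _ HN] := sp e e0; exists N => m Nm i.
  have := HN m Nm; rewrite /= => h; rewrite distrC; apply: le_trans h.
  rewrite [leRHS]/Num.Def.normr/= mx_normrE.
  by have := @le_bigmax _ _ _ 0 (fun ij => `|(p - s m) ij.1 ij.2|) (0, i); rewrite /= !mxE.
apply/cvgrPdist_le => e e0; have [N HN] := H e e0; exists N => // m Nm.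
rewrite /= [leLHS]/Num.Def.normr/= mx_normrE.
apply: bigmax_le; first exact: ltW.
by move=> [a i] _; rewrite /= (ord1 a) !mxE distrC; exact: HN.
Qed.

End row_sequences.

Section completion_fibre.
Variables (R : realType) (k : nat).
Variables (g : 'rV[R]_(2 + k) -> 'M[R]_(2 + k)) (D : set 'rV[R]_(2 + k)).
Variable z : 'rV[R]_k.
Let p := corner_point z.
Implicit Types (s t : nat -> 'rV[R]_(2 + k)) (w q : 'rV[R]_(2 + k)).

Lemma intrinsic_dist_ge0 w w' : (0 <= intrinsic_dist g D w w')%E.
Proof.
by apply: le_ereal_inf_tmp => _ [c [_ _ _ _ ->]]; exact: curve_length_ge0.
Qed.

(** A representative tending to [p] would stay within distance 1 of one of its own terms, while the
    distance from that term blows up near the corner. *)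
Lemma completion_fibre_eq0 :
  (forall w, D w -> forall K : R, exists2 r : R, 0 < r &
    forall w', radial w' <= r -> (K%:E <= intrinsic_dist g D w w')%E) ->
  completion_fibre g D p = set0.
Proof.
move=> unb; apply/seteqP; split => // C [[s0 _ ->] [s [[sD sC] _] sp]].
have [N HN] := sC 1 ltr01.
have [r r0 Hr] := unb _ (sD N) 1.
have r20 : 0 < r / 2 by rewrite divr_gt0.
have [M HM] := (cvg_coordP s p).1 sp _ r20.
have pl (i : 'I_2) : p 0 (lshift k i) = 0 by rewrite /p /corner_point row_mxEl mxE.
pose j := maxn N M.
have := HN N j (leqnn N) (leq_maxl _ _); apply/negP; rewrite -leNgt; apply: Hr.
have h i := HM j (leq_maxr _ _) (lshift k i).
have := h 0; have := h 1; rewrite !pl !subr0 => h1 h0.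
rewrite /radial /xc /yc (splitr r).
by apply: lerD; apply: le_trans (ler_norm _) _.
Qed.

Hypothesis close : forall e : R, 0 < e -> exists2 d : R, 0 < d &
  forall w w', D w -> D w' -> (forall i, `|w 0 i - p 0 i| <= d) ->
    (forall i, `|w' 0 i - p 0 i| <= d) -> (intrinsic_dist g D w w' <= e%:E)%E.

Lemma cvg_corner_cauchy s : (forall i, D (s i)) -> s @ \oo --> p ->
  intrinsic_cauchy g D s.
Proof.
move=> sD /cvg_coordP sp; split => // e e0.
have e20 : 0 < e / 2 by rewrite divr_gt0.
have [d d0 Hd] := close e20; have [N HN] := sp _ d0.
exists N => i j Ni Nj.
apply: (le_lt_trans (Hd _ _ (sD i) (sD j) (HN _ Ni) (HN _ Nj))).
by rewrite lte_fin ltr_pdivrMr// ltr_pMr// ltr1n.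
Qed.

Lemma cvg_corner_equiv s t : (forall i, D (s i)) -> (forall i, D (t i)) ->
  s @ \oo --> p -> t @ \oo --> p -> intrinsic_equiv g D s t.
Proof.
move=> sD tD /cvg_coordP sp /cvg_coordP tp.
have ev e : 0 < e -> exists N, forall i, (N <= i)%N ->
    (intrinsic_dist g D (s i) (t i) <= e%:E)%E.
  move=> e0; have [d d0 Hd] := close e0.
  have [N1 HN1] := sp _ d0; have [N2 HN2] := tp _ d0.
  exists (maxn N1 N2) => i; rewrite geq_max => /andP[i1 i2].
  by apply: Hd => //; [exact: HN1|exact: HN2].
have fin i e : (intrinsic_dist g D (s i) (t i) <= e%:E)%E ->
    intrinsic_dist g D (s i) (t i) \is a fin_num.
  by move=> h; rewrite ge0_fin_numE ?intrinsic_dist_ge0// (le_lt_trans h)// ltry.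
apply/fine_cvgP; split.
  by have [N HN] := ev 1 ltr01; exists N => // i /= /HN; exact: fin.
apply/cvgrPdist_le => e e0; have [N HN] := ev e e0; exists N => // i /= /HN h.
rewrite sub0r normrN ger0_norm ?fine_ge0 ?intrinsic_dist_ge0//.
by rewrite -lee_fin fineK// (fin _ e).
Qed.

Variable m : R.
Hypothesis m0 : 0 < m.
Hypothesis dist_ge : forall w w' i,
  ((m * `|w' 0 i - w 0 i|)%:E <= intrinsic_dist g D w w')%E.

Lemma intrinsic_equiv_cvg s t q : intrinsic_equiv g D s t ->
  (s @ \oo --> q <-> t @ \oo --> q).
Proof.
move=> st.
have ev e : 0 < e -> exists N, forall j, (N <= j)%N -> forall i,
    `|t j 0 i - s j 0 i| <= e.
  move=> e0; have /fine_cvgP[[N1 _ fin] /cvgrPdist_le/(_ _ (mulr_gt0 m0 e0))[N2 _ HN]] := st.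
  exists (maxn N1 N2) => j; rewrite geq_max => /andP[/fin/= fj /HN/= hj] i.
  rewrite -(ler_pM2l m0) -lee_fin; apply: le_trans (dist_ge _ _ _) _.
  rewrite -(fineK fj) lee_fin; apply: le_trans hj.
  by rewrite sub0r normrN ler_norm.
split=> /cvg_coordP H; apply/cvg_coordP => e e0;
  have e20 : 0 < e / 2 by [rewrite divr_gt0];
  have [N1 h1] := H _ e20; have [N2 h2] := ev _ e20;
  exists (maxn N1 N2) => j; rewrite geq_max => /andP[/h1 {}h1 /h2 {}h2] i.
  rewrite -(subrKA (s j 0 i)) (splitr e); apply: le_trans (ler_normD _ _) _.
  exact: lerD.
rewrite -(subrKA (t j 0 i)) (splitr e); apply: le_trans (ler_normD _ _) _.
by rewrite distrC; exact: lerD.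
Qed.

(** Equivalent sequences share their Euclidean limit, and sequences tending to [p] are equivalent by
    [close]; so every class over [p] is the same set, and [s] shows that it occurs. *)
Lemma completion_fibre_eq1 s : (forall i, D (s i)) -> s @ \oo --> p ->
  completion_fibre g D p =
    [set [set t | intrinsic_cauchy g D t /\ t @ \oo --> p]].
Proof.
move=> sD sp.
have classE s' : (forall i, D (s' i)) -> s' @ \oo --> p ->
    [set t | intrinsic_cauchy g D t /\ intrinsic_equiv g D s' t] =
    [set t | intrinsic_cauchy g D t /\ t @ \oo --> p].
  move=> s'D s'p; apply/seteqP; split => t [tC tE]; split => //.
    exact/(intrinsic_equiv_cvg _ tE).
  by apply: cvg_corner_equiv => //; case: tC.
apply/seteqP; split => [C [[s0 s0C ->] [s1 [s1C s01] s1p]]|_ ->] /=.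
  apply: classE; first by case: s0C.
  exact/(intrinsic_equiv_cvg _ s01).
split; last by exists s => //; split => //; exact: cvg_corner_cauchy.
exists s; first exact: cvg_corner_cauchy.
by rewrite classE.
Qed.

End completion_fibre.

(** * Assembling the trichotomy *)

Section metric_bounds.
Variables (R : realType) (n : nat).

Lemma quadZ (a : R) (g : 'M[R]_n) v : quad (a *: g) v = a * quad g v.
Proof. by rewrite /quad -scalemxAr -scalemxAl mxE. Qed.

(** Gathers everything under one root, in the shape produced by the bounds on [Fmu]. *)
Lemma sqrt_exp_mul (a e T : R) (j : nat) (x : R) : 0 <= a -> 0 <= T -> 0 <= x ->
  expR j%:R * (Num.sqrt a * Num.sqrt T) * x =
  Num.sqrt (a * (expR (2 * j%:R) * T) * x ^+ 2).
Proof.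
move=> a0 T0 x0.
rewrite sqrtrM ?mulr_ge0 ?expR_ge0// sqrtr_sqr (ger0_norm x0); congr (_ * _).
rewrite sqrtrM// mulrCA sqrtrM ?expR_ge0//; congr (_ * (_ * _)).
by rewrite expRM_natl sqrtr_sqr ger0_norm// expR_ge0.
Qed.

End metric_bounds.

Theorem theorem7p13 (R : realType) (k : nat)
  (V : set 'rV[R]_k) (eps : R)
  (g0 : 'rV[R]_(2 + k) -> 'M[R]_(2 + k)) (c0 C0 : R)
  (mu : {finite_measure set (R * R)%type -> \bar R})
  (u : R * R -> 'rV[R]_(2 + k) -> R) (cu Cu : R)
  (zB : 'rV[R]_k) (rB : R) (S0 : R) (z0 : 'rV[R]_k) :
  let U := chart eps V in
  let Uint := open_chart eps V in
  let E := msupport mu in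
  let B := eball zB rB in
  let UB := open_chart eps B in
  let g := gmu mu u g0 in
  let p := corner_point z0 in
  let fibre := completion_fibre g UB p in
  open V ->
  0 < eps < 1 ->
  riemannian_metric U g0 ->
  0 < c0 -> c0 <= C0 ->
  (forall w v, U w ->
     c0 * enorm v ^+ 2 <= quad (g0 w) v <= C0 * enorm v ^+ 2) ->
  mu setT != 0%E ->
  compact E ->
  (forall a, E a -> 0 <= a.1 /\ 0 <= a.2) ->
  (forall a w, E a -> Uint w -> 0 < u a w) ->
  jointly_measurable E Uint u ->
  0 < cu ->
  {ae mu, forall a, E a -> forall w, Uint w -> cu <= u a w <= Cu} ->
  {within Uint, continuous (Fmu mu u)} ->
  (forall w, Uint w -> 0 < Fmu mu u w) ->
  0 < rB -> compact (closure B) -> closure B `<=` V ->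
  0 <= S0 ->
  B z0 ->
  exactly_one_of_three
    [/\ 2 < Amu mu,
        infinite_intrinsic_distance g UB p &
        fibre = set0]
    [/\ Amu mu <= 2, sqrt_Tmu_integral mu S0 = +oo%E,
        infinite_intrinsic_distance g UB p &
        fibre = set0]
    [/\ Amu mu <= 2, (sqrt_Tmu_integral mu S0 < +oo)%E,
        exists C, fibre = [set C],
        forall s : nat -> 'rV[R]_(2 + k), (forall i, UB (s i)) ->
          s @ \oo --> p -> intrinsic_cauchy g UB s &
        forall s t : nat -> 'rV[R]_(2 + k),
          (forall i, UB (s i)) -> (forall i, UB (t i)) ->
          s @ \oo --> p -> t @ \oo --> p -> intrinsic_equiv g UB s t]
  /\ ~ (exists C1 C2, [/\ fibre C1, fibre C2 & C1 <> C2]).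
Proof.
move=> U Uint E B UB g p fibre oV /andP[eps0 eps1] _ c00 cC0 g0bound muT cE E0
  upos umeas cu0 ubound _ Fpos rB0 _ BV S00 Bz0.
have C00 : 0 < C0 by exact: lt_le_trans cC0.
have UBU w : UB w -> Uint w.
  by move=> [? ? Bw]; split => //; exact/BV/subset_closure.
have UintU w : Uint w -> U w.
  by move=> [/andP[/ltW x0 x1] /andP[/ltW y0 y1] Vw]; split => //; rewrite ?x0 ?y0.
have UB0 w : UB w -> 0 < xc w /\ 0 < yc w.
  by move=> [/andP[? _] /andP[? _] _].
have mu_w w : UB w -> measurable_fun (msupport mu) (u ^~ w).
  move=> /UBU Uw; apply: (jointly_measurable_section _ _ umeas Uw).
    exact: measurable_msupport.
  exact: open_open_chart.
(* The weight bounds ask for a nonnegative upper constant, hence the absolute value of [Cu]. *)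
have ub w : UB w -> {ae mu, forall a, msupport mu a -> cu <= u a w <= `|Cu|}.
  move=> /UBU Uw; apply: filterS ubound => a H Ea.
  by have /andP[-> h] := H Ea _ Uw; rewrite (le_trans h)// ler_norm.
have uw0 w : UB w -> forall a, msupport mu a -> 0 < u a w.
  by move=> /UBU Uw a Ea; exact: upos.
pose thl j := Num.sqrt (cu * c0) * sqrtT mu j.
pose thu j := Num.sqrt (`|Cu| * C0) * sqrtT mu j.
have thl0 j : 0 <= thl j by rewrite mulr_ge0 ?sqrtr_ge0.
have thu0 j : 0 <= thu j by rewrite mulr_ge0 ?sqrtr_ge0.
have g_ge j w v : UB w -> xc w <= expR (- j%:R) -> yc w <= expR (- j%:R) ->
    expR j%:R * thl j * enorm v <= Num.sqrt (quad (g w) v).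
  move=> UBw xw yw; have [x0 y0] := UB0 w UBw.
  rewrite /thl sqrt_exp_mul ?Tmu_ge0 ?enorm_ge0 ?mulr_ge0 ?(ltW cu0) ?(ltW c00)//.
  rewrite ler_wsqrtr// quadZ.
  have F := Fmu_ge cE E0 (mu_w w UBw) cu0 (normr_ge0 Cu) (ub w UBw) (uw0 w UBw) x0 y0 xw yw.
  have /andP[q _] := g0bound w v (UintU _ (UBU _ UBw)).
  apply: le_trans (ler_pM _ _ F q).
  - by rewrite le_eqVlt; apply/orP; left; apply/eqP; ring.
  - by rewrite mulr_ge0 ?(ltW cu0)// mulr_ge0 ?expR_ge0 ?Tmu_ge0.
  - by rewrite mulr_ge0 ?sqr_ge0// ltW.
have g_le j w v : UB w -> expR (- j%:R) <= xc w -> expR (- j%:R) <= yc w ->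
    Num.sqrt (quad (g w) v) <= expR j%:R * thu j * enorm v.
  move=> UBw xw yw; have [x0 y0] := UB0 w UBw.
  rewrite /thu sqrt_exp_mul ?Tmu_ge0 ?enorm_ge0 ?mulr_ge0 ?(ltW C00)//.
  rewrite ler_wsqrtr// quadZ.
  have F := Fmu_le cE E0 (mu_w w UBw) (normr_ge0 Cu) (ub w UBw) (uw0 w UBw) x0 y0 xw yw.
  have /andP[_ q] := g0bound w v (UintU _ (UBU _ UBw)).
  have q0 : 0 <= quad (g0 w) v.
    have /andP[q0 _] := g0bound w v (UintU _ (UBU _ UBw)).
    by apply: le_trans q0; rewrite mulr_ge0 ?sqr_ge0// ltW.
  apply: le_trans (ler_pM (ltW (Fpos _ (UBU _ UBw))) q0 F q) _.
  by rewrite le_eqVlt; apply/orP; left; apply/eqP; ring.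
(* Alternatives (i) and (ii) differ only in why the series diverges. *)
have diverging : (forall M K, exists2 N, (M <= N)%N & K < \sum_(M <= j < N) sqrtT mu j) ->
    infinite_intrinsic_distance g UB p /\ fibre = set0.
  move=> div.
  have thl_div M K : exists2 N, (M <= N)%N & K < \sum_(M <= j < N) thl j.
    have sc : 0 < Num.sqrt (cu * c0) by rewrite sqrtr_gt0 mulr_gt0.
    have [N MN KN] := div M (K / Num.sqrt (cu * c0)); exists N => //.
    by rewrite -mulr_sumr mulrC -ltr_pdivrMr.
  split; first exact: (infinite_intrinsic_distance_corner thl0 UB0 g_ge thl_div).
  apply: completion_fibre_eq0.
  exact: intrinsic_dist_unbounded thl0 UB0 g_ge thl_div.
have [A2|A2] := leP (Amu mu) 2; last first.
  have [inf f0] := diverging (sum_sqrtT_diverges_gt2 cE E0 muT A2).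
  split; last by move=> [C1 [C2]]; rewrite f0 => -[].
  by constructor 1; split => //; case.
have [Ioo|Ifin] := eqVneq (sqrt_Tmu_integral mu S0) +oo%E.
  have [inf f0] := diverging (sum_sqrtT_diverges_int cE E0 S00 Ioo).
  split; last by move=> [C1 [C2]]; rewrite f0 => -[].
  constructor 2; split => //; first by case.
  by case=> _; rewrite Ioo ltxx.
have {}Ifin : (sqrt_Tmu_integral mu S0 < +oo)%E by rewrite ltey.
(* The lower metric bound of index 0 holds on the whole chart, since the coordinates are below
   [eps < 1]. *)
have m0 : 0 < Num.sqrt (cu * c0 * Tmu mu 0).
  by rewrite sqrtr_gt0 !mulr_gt0// Tmu0_gt0.
have dist_ge (w w' : 'rV[R]_(2 + k)) i :
    ((Num.sqrt (cu * c0 * Tmu mu 0) * `|w' 0 i - w 0 i|)%:E <= intrinsic_dist g UB w w')%E.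
  apply: intrinsic_dist_ge_coord => [|a v aUB]; first exact: ltW.
  have [/andP[_ x1] /andP[_ y1] _] := aUB.
  have -> : Num.sqrt (cu * c0 * Tmu mu 0) = thl 0.
    by rewrite sqrtrM// mulr_ge0// ltW.
  have := g_ge 0 a v aUB; rewrite oppr0 expR0 mul1r.
  by apply; apply/ltW; [exact: lt_trans x1 eps1|exact: lt_trans y1 eps1].
have close e : 0 < e -> exists2 d : R, 0 < d &
    forall w w', UB w -> UB w' -> (forall i, `|w 0 i - p 0 i| <= d) ->
    (forall i, `|w' 0 i - p 0 i| <= d) -> (intrinsic_dist g UB w w' <= e%:E)%E.
  move=> e0; pose K := Num.sqrt (2 + k)%:R * 4 * expR 2 * Num.sqrt (`|Cu| * C0).
  have K0 : 0 <= K by rewrite !mulr_ge0 ?sqrtr_ge0 ?expR_ge0.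
  (* The tail is made smaller than e / (K + 1); adding 1 avoids dividing by a vanishing [K]. *)
  have [N0 HN0] := sum_sqrtT_tail cE E0 A2 Ifin (divr_gt0 e0 (ltr_wpDl K0 (@ltr01 R))).
  pose N1 := (Num.truncn (- ln (eps / 2))).+1.
  pose N := maxn N0 N1.
  (* Leaves the arc room below [eps]. *)
  have Neps : expR (- N%:R) < eps / 2.
    rewrite -[ltRHS]lnK ?posrE ?divr_gt0// ltr_expR ltrNl.
    by apply: lt_le_trans (truncnS_gt _) _; rewrite ler_nat leq_maxr.
  have rho0 : 0 < expR (- N%:R) :> R by exact: expR_gt0.
  (* Half of e^-N, so that two points this close to [p] are within e^-N of each other. *)
  exists (expR (- N%:R) / 2); first by rewrite divr_gt0.
  move=> w w' Dw Dw' wp w'p.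
  have pl (i : 'I_2) : p 0 (lshift k i) = 0 by rewrite /p /corner_point row_mxEl mxE.
  have small (a : 'rV[R]_(2 + k)) i :
      (forall i, `|a 0 i - p 0 i| <= expR (- N%:R) / 2) ->
      a 0 (lshift k i) + expR (- N%:R) < eps.
    by move=> /(_ (lshift k i)); rewrite pl subr0 ler_norml => /andP[_ h]; lra.
  apply: le_trans (intrinsic_dist_le thu0 g_le Dw Dw' _ _) _.
  - move=> i; rewrite -(subrKA (p 0 i)); apply: le_trans (ler_normD _ _) _.
    by rewrite (splitr (expR _)); apply: lerD; rewrite // distrC.
  - by split; exact: small.
  rewrite (@eq_eseriesr _ _ (fun j => K%:E * (sqrtT mu (N.+2 + j))%:E)%E); last first.
    by move=> j _; rewrite /thu /K -EFinM mulrA.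
  rewrite nneseriesZl; last by move=> j _; rewrite lee_fin sqrtr_ge0.
  have /(lee_wpmul2l (_ : 0 <= K%:E)%E) h := HN0 N.+2 (leqW (leqW (leq_maxl _ _))).
  apply: le_trans (h _) _; first by rewrite lee_fin.
  rewrite -EFinM lee_fin mulrCA ger_pMr// ler_pdivrMr ?ltr_wpDl// mul1r.
  by rewrite lerDl.
pose dir : 'rV[R]_(2 + k) := row_mx (const_mx 1) 0.
(* A sequence descending diagonally to [p] inside the chart, showing that the fibre is not empty. *)
pose s (n : nat) : 'rV[R]_(2 + k) := p + (eps / 2 / n.+1%:R) *: dir.
have scoord n i : s n 0 i = p 0 i + eps / 2 / n.+1%:R * dir 0 i.
  by rewrite /s; move: (dir) (p) => a b; rewrite !mxE.
have sE n i : s n 0 (lshift k i) = eps / 2 / n.+1%:R.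
  rewrite scoord /p /corner_point /dir !row_mxEl [X in X + _]mxE add0r.
  by rewrite [X in _ * X]mxE mulr1.
have sz n : zc (s n) = z0.
  apply/rowP => i; rewrite /zc mxE scoord /p /corner_point /dir !row_mxEr.
  by rewrite [X in _ * X]mxE mulr0 addr0.
have s_bd n : 0 < eps / 2 / n.+1%:R < eps.
  rewrite !divr_gt0//= ltr_pdivrMr// (@lt_le_trans _ _ eps)//; first lra.
  by rewrite ler_peMr ?ler1n// ltW.
have sUB n : UB (s n).
  by split; rewrite /xc /yc ?sE ?s_bd// sz.
have sp : s @ \oo --> p.
  apply/cvg_coordP => e e0; exists (Num.truncn (eps / 2 / e)).+1 => n Nn i.
  have /andP[n0 _] := s_bd n.
  have -> : s n 0 i - p 0 i = eps / 2 / n.+1%:R * dir 0 i.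
    by rewrite scoord addrC addKr.
  have dir1 : `|dir 0 i| <= 1.
    rewrite /dir mxE; case: fintype.splitP => j _; rewrite mxE ?normr1// normr0.
    exact: ler01.
  rewrite normrM (gtr0_norm n0); apply: (@le_trans _ _ (eps / 2 / n.+1%:R)).
    by rewrite ger_pMr.
  rewrite ler_pdivrMr// (mulrC e) -ler_pdivrMr//.
  apply: ltW; apply: lt_le_trans (truncnS_gt (eps / 2 / e)) _.
  by rewrite ler_nat leqW.
have fE := completion_fibre_eq1 close m0 dist_ge sUB sp.
split; last by move=> [C1 [C2 []]]; rewrite /fibre fE => -> ->.
constructor 3; split; [by case|by case=> _ h; move: Ifin; rewrite h ltxx|].
split => //; first by exists [set t | intrinsic_cauchy g UB t /\ t @ \oo --> p].
  exact: cvg_corner_cauchy close.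
exact: cvg_corner_equiv close.
Qed.
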